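(* There exists a deterministic algorithm that, given a full-rank matrix $X \in \mathbb{R}^{m \times n}$ with $m < n$ and a sampling parameter $k \in \{m, m+1, \dots, n\}$, constructs a subset $\mathcal{S} \subseteq \{1,\dots,n\}$ of cardinality $k$ such that $X_{\mathcal{S}}$ has full rank (that is, rank $m$) and, for both $\xi = 2$ and $\xi = F$, $$\Vert X_{\mathcal{S}}^\dagger\Vert_\xi^2 \leq \frac{n}{m}\left(\frac{\sqrt{(k-1)m+1}-1}{\sqrt{(k-1)m+1}-k}\right)^2 \Vert X^\dagger\Vert_\xi^2 ,$$ where for $m = k = 1$ the right-hand side is understood as the limit $k \to 1+$, i.e. the bound reads $\Vert X_{\mathcal{S}}^\dagger\Vert_\xi^2 \leq n \Vert X^\dagger\Vert_\xi^2$. Additionally, the same $\mathcal{S}$ satisfies the slightly looser bound, for both $\xi = 2$ and $\xi = F$, $$\Vert X_{\mathcal{S}}^\dagger\Vert_\xi^2 \leq \frac{n}{\left(\sqrt{k}-\sqrt{m-1}\right)^2}\Vert X^\dagger\Vert_\xi^2 .$$ The algorithm runs in $O(k m^3 + k m T_X)$ operations, where $T_X \geq n$ is the complexity of multiplying $X^T$ by a vector of length $m$. For a general dense matrix the total complexity becomes $O(nkm^2)$.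
   Context: $X_{\mathcal{S}}$ denotes the submatrix of $X$ formed by the columns indexed by $\mathcal{S}$; $A^\dagger$ is the Moore–Penrose pseudoinverse; $\Vert\cdot\Vert_2$ is the spectral norm and $\Vert\cdot\Vert_F$ the Frobenius norm. Operation counts are numbers of arithmetic operations, with the convention that a full eigenvalue decomposition of a symmetric $m \times m$ matrix costs $O(m^3)$, and that a one-dimensional bisection or golden-section search on a scalar function whose evaluation costs $O(m)$ is itself counted as $O(m)$ (a fixed target precision is assumed, so logarithmic factors in the precision are omitted). *)

(* Defs.v *)
From HB Require Import structures.
From mathcomp Require Import all_boot all_order all_algebra.
From mathcomp Require Import boolp classical_sets reals.
Set Implicit Arguments.
Unset Strict Implicit.
Unset Printing Implicit Defensive.
Import Order.TTheory GRing.Theory Num.Theory.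
Local Open Scope ring_scope.

Section MatrixNotions.
Variable R : realType.

Definition norm2 n (x : 'cV[R]_n) : R := Num.sqrt (\sum_i x i 0 ^+ 2).

(* The operator norm induced by [norm2]. *)
Definition spectral_norm m n (A : 'M[R]_(m, n)) : R :=
  sup [set norm2 (A *m x) | x in [set x : 'cV[R]_n | norm2 x <= 1]]%classic.

Definition frobenius_norm m n (A : 'M[R]_(m, n)) : R :=
  Num.sqrt (\sum_i \sum_j A i j ^+ 2).

Inductive norm_kind := Spectral | Frobenius.

Definition mxnorm (xi : norm_kind) m n (A : 'M[R]_(m, n)) : R :=
  match xi with
  | Spectral => spectral_norm A
  | Frobenius => frobenius_norm A
  end.

Definition penrose m n (A : 'M[R]_(m, n)) (B : 'M[R]_(n, m)) : Prop :=
  [/\ A *m B *m A = A, B *m A *m B = B,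
      (A *m B)^T = A *m B & (B *m A)^T = B *m A].

Definition mpinv m n (A : 'M[R]_(m, n)) : 'M[R]_(n, m) :=
  xget 0 [set B | penrose A B]%classic.

Lemma penrose_uniq m n (A : 'M[R]_(m, n)) B C :
  penrose A B -> penrose A C -> B = C.
Proof.
move=> [ABA BAB ABt BAt] [ACA CAC ACt CAt].
have eAB : A *m B = A *m C.
  by rewrite -ABt -{1}ACA -mulmxA trmx_mul ABt ACt mulmxA ABA.
have eBA : B *m A = C *m A.
  rewrite -CAt -{2}ABA -[A *m B *m A]mulmxA mulmxA trmx_mul BAt CAt.
  by rewrite -[B *m A *m _]mulmxA [A *m (C *m A)]mulmxA ACA.
by rewrite -BAB eBA -mulmxA eAB mulmxA CAC.
Qed.

Lemma trmx_mul_self_eq0 m n (A : 'M[R]_(m, n)) : A^T *m A = 0 -> A = 0.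
Proof.
move=> A0; apply/matrixP => i j; rewrite mxE.
have /eqP := congr1 (fun M : 'M_n => M j j) A0; rewrite !mxE.
rewrite psumr_eq0; last by move=> l _; rewrite !mxE -expr2 sqr_ge0.
by move=> /allP /(_ i (mem_index_enum _)); rewrite !mxE -expr2 sqrf_eq0 => /eqP.
Qed.

Lemma gram_unitmx m n (A : 'M[R]_(m, n)) :
  row_free A -> A *m A^T \in unitmx.
Proof.
move=> Af; rewrite -row_free_unit; apply/inj_row_free => v vG.
apply/eqP; rewrite -(mulmx_free_eq0 v Af) -trmx_eq0; apply/eqP.
apply: trmx_mul_self_eq0.
by rewrite trmxK trmx_mul mulmxA -[v *m A *m _]mulmxA vG mul0mx.
Qed.

Lemma penrose_exists m n (A : 'M[R]_(m, n)) : exists B, penrose A B.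
Proof.
move: (mulmx_base A) (col_base_full A) (row_base_free A).
move: (\rank A) (col_base A) (row_base A) => r U V AE Uf Vf.
have VV : V *m V^T \in unitmx by exact: gram_unitmx.
have UU : U^T *m U \in unitmx.
  by rewrite -[X in _ *m X]trmxK; apply: gram_unitmx; rewrite /row_free mxrank_tr.
set G := invmx (V *m V^T); set H := invmx (U^T *m U).
exists (V^T *m G *m H *m U^T).
have Gt : G^T = G by rewrite trmx_inv trmx_mul trmxK.
have Ht : H^T = H by rewrite trmx_inv trmx_mul trmxK.
have AB : A *m (V^T *m G *m H *m U^T) = U *m H *m U^T.
  by rewrite -AE !mulmxA -[U *m V *m _]mulmxA -[U *m _ *m G]mulmxA mulmxV// mulmx1.
have BA : V^T *m G *m H *m U^T *m A = V^T *m G *m V.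
  rewrite -AE !mulmxA -[_ *m U^T *m U]mulmxA -[_ *m H *m (_ *m _)]mulmxA.
  by rewrite mulVmx// mulmx1.
split.
- by rewrite AB -AE !mulmxA -[_ *m U^T *m U]mulmxA -[U *m H *m _]mulmxA mulVmx// mulmx1.
- rewrite BA !mulmxA -[_ *m V *m V^T]mulmxA -[V^T *m G *m (_ *m _)]mulmxA.
  by rewrite mulVmx// ?mulmx1.
- by rewrite AB !trmx_mul trmxK Ht mulmxA.
- by rewrite BA !trmx_mul trmxK Gt mulmxA.
Qed.

Lemma mpinvP m n (A : 'M[R]_(m, n)) : penrose A (mpinv A).
Proof.
by rewrite /mpinv; apply: (@xgetPex _ _ [set B | penrose A B]%classic);
   exact: penrose_exists.
Qed.

Definition colset m n (X : 'M[R]_(m, n)) (S : {set 'I_n}) : 'M[R]_(m, #|S|) :=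
  colsub (fun j : 'I_#|S| => enum_val j) X.

(* The denominator sqrt((k-1)m+1) - k vanishes on m <= k only at m = k = 1,
   where the formula is replaced by its limit. *)
Definition sharp_factor (m n k : nat) : R :=
  let q := Num.sqrt ((k%:R - 1) * m%:R + 1) in
  if (m == 1%N) && (k == 1%N) then n%:R
  else n%:R / m%:R * ((q - 1) / (q - k%:R)) ^+ 2.

Definition loose_factor (m n k : nat) : R :=
  n%:R / (Num.sqrt k%:R - Num.sqrt (m%:R - 1)) ^+ 2.

End MatrixNotions.

(* A real RAM.  The algorithm is one program text, the same for all m, n, k and
   X.  A program can neither inspect a real number other than by comparison nor
   round it, and every loop is a counted loop, so every program terminates.
   Integer and real memory are arrays named by natural numbers and initially
   zero; integer variable x is the cell (x, 0) of integer memory. *)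

Inductive iexp :=
  | INum of nat
  | IDimM | IDimN | IDimK
  | IArr of nat & iexp
  | IAdd of iexp & iexp
  | ISub of iexp & iexp.                        (* truncated *)

Definition IVar (x : nat) := IArr x (INum 0).

Inductive rexp :=
  | RNat of iexp
  | RX of iexp & iexp                           (* entry of the input X *)
  | RArr of nat & iexp & iexp
  | RAdd of rexp & rexp
  | RSub of rexp & rexp
  | RMul of rexp & rexp
  | RDiv of rexp & rexp
  | RSqrt of rexp
  | RSum of nat & iexp & rexp.                  (* \sum_(x < bound) body *)

Inductive bexp :=
  | BLeR of rexp & rexp
  | BLtR of rexp & rexp
  | BLeN of iexp & iexp
  | BEqN of iexp & iexp
  | BNot of bexp
  | BAnd of bexp & bexp.

Inductive cmd :=
  | Skip
  | Seq of cmd & cmd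
  | SetN of nat & iexp & iexp                   (* ints a i := e *)
  | SetR of nat & iexp & iexp & rexp            (* reals a i j := e *)
  | If of bexp & cmd & cmd
  | For of nat & iexp & cmd                     (* for x = 0 .. bound-1 *)
  | MulXT                                       (* row 0 of rout := X^T (row 0 of rin) *)
  | Evd of nat & nat & nat & iexp               (* input, eigenvectors, eigenvalues, order *)
  | Bisect of nat & rexp & rexp & rexp          (* cell x := sign change of e in [lo, hi] *)
  | Golden of nat & rexp & rexp & rexp.         (* cell x := maximizer of e in [lo, hi] *)

(* X^T is multiplied by row 0 of real array [rin], into row 0 of real array
   [rout]; the chosen columns are read off the first k cells of integer array
   [out]. *)
Definition rin : nat := 0.
Definition rout : nat := 1.
Definition out : nat := 0.

(* Subroutines admitted as primitives; their running times are charged by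
   [exec]. *)
Record subroutines (R : realType) := Subroutines {
  evd : forall d, 'M[R]_d -> 'M[R]_d * 'rV[R]_d;
  bisect : (R -> R) -> R -> R -> R;
  golden : (R -> R) -> R -> R -> R
}.

Section Machine.
Variable R : realType.

Definition evd_correct (ev : forall d, 'M[R]_d -> 'M[R]_d * 'rV[R]_d) :=
  forall d (A : 'M[R]_d), A^T = A ->
    let: (U, l) := ev d A in
    U *m U^T = 1%:M /\ A = U *m diag_mx l *m U^T.

(* What bisection guarantees: a sign change within distance [eps]. *)
Definition bisect_correct (eps : R) (bis : (R -> R) -> R -> R -> R) :=
  forall f a b, a <= b -> f a * f b <= 0 ->
    exists x y, [/\ a <= x, x <= bis f a b <= y, y <= b, y - x <= eps
                  & f x * f y <= 0].

Definition golden_correct (eps : R) (gold : (R -> R) -> R -> R -> R) :=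
  forall f a b c, a <= c <= b ->
    (forall x y, a <= x -> x < y -> y <= c -> f x < f y) ->
    (forall x y, c <= x -> x < y -> y <= b -> f y < f x) ->
    a <= gold f a b <= b /\ `|gold f a b - c| <= eps.

Definition correct_subroutines (eps : R) (sub : subroutines R) :=
  [/\ evd_correct (@evd R sub), bisect_correct eps (@bisect R sub)
    & golden_correct eps (@golden R sub)].

Definition imem := nat -> nat -> nat.
Definition rmem := nat -> nat -> nat -> R.

Record config := Config { ints : imem; reals : rmem; ops : nat }.

Definition iput (N : imem) a i v : imem :=
  fun a' i' => if (a' == a) && (i' == i) then v else N a' i'.
Definition rput (A : rmem) a i j v : rmem :=
  fun a' i' j' => if [&& a' == a, i' == i & j' == j] then v else A a' i' j'.

Definition tick c st := Config (ints st) (reals st) (ops st + c).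
Definition set_ints N st := Config N (reals st) (ops st).
Definition set_reals A st := Config (ints st) A (ops st).

Variables (sub : subroutines R) (m n k : nat) (X : 'M[R]_(m, n)).
(* The cost of one multiplication of X^T by a vector. *)
Variable TX : nat.

Fixpoint ieval (N : imem) (e : iexp) : nat :=
  match e with
  | INum c => c
  | IDimM => m
  | IDimN => n
  | IDimK => k
  | IArr a i => N a (ieval N i)
  | IAdd e1 e2 => ieval N e1 + ieval N e2
  | ISub e1 e2 => ieval N e1 - ieval N e2
  end%N.

(* Costs count arithmetic operations, comparisons, assignments and loop
   iterations, on integers and on reals, at one unit each. *)
Fixpoint icost (e : iexp) : nat :=
  match e with
  | INum _ | IDimM | IDimN | IDimK => 0
  | IArr _ i => icost i
  | IAdd e1 e2 | ISub e1 e2 => (icost e1 + icost e2).+1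
  end%N.

Definition entry (i j : nat) : R :=
  if (insub i, insub j) is (Some i', Some j') then X i' j' else 0.

(* Total conventions of the library: x / 0 = 0, and the square root of a
   negative number is 0. *)
Fixpoint reval (N : imem) (A : rmem) (e : rexp) : R :=
  match e with
  | RNat i => (ieval N i)%:R
  | RX i j => entry (ieval N i) (ieval N j)
  | RArr a i j => A a (ieval N i) (ieval N j)
  | RAdd e1 e2 => reval N A e1 + reval N A e2
  | RSub e1 e2 => reval N A e1 - reval N A e2
  | RMul e1 e2 => reval N A e1 * reval N A e2
  | RDiv e1 e2 => reval N A e1 / reval N A e2
  | RSqrt e1 => Num.sqrt (reval N A e1)
  | RSum x b e1 => \sum_(i < ieval N b) reval (iput N x 0 i) A e1
  end.

Fixpoint rcost (N : imem) (e : rexp) : nat :=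
  match e with
  | RNat i => icost i
  | RX i j | RArr _ i j => icost i + icost j
  | RAdd e1 e2 | RSub e1 e2 | RMul e1 e2 | RDiv e1 e2 =>
      (rcost N e1 + rcost N e2).+1
  | RSqrt e1 => (rcost N e1).+1
  | RSum x b e1 =>
      icost b + \sum_(i < ieval N b) (rcost (iput N x 0 i) e1).+1
  end%N.

Fixpoint beval (N : imem) (A : rmem) (b : bexp) : bool :=
  match b with
  | BLeR e1 e2 => reval N A e1 <= reval N A e2
  | BLtR e1 e2 => reval N A e1 < reval N A e2
  | BLeN e1 e2 => (ieval N e1 <= ieval N e2)%N
  | BEqN e1 e2 => ieval N e1 == ieval N e2
  | BNot b1 => ~~ beval N A b1
  | BAnd b1 b2 => beval N A b1 && beval N A b2
  end.

Fixpoint bcost (N : imem) (b : bexp) : nat :=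
  match b with
  | BLeR e1 e2 | BLtR e1 e2 => (rcost N e1 + rcost N e2).+1
  | BLeN e1 e2 | BEqN e1 e2 => (icost e1 + icost e2).+1
  | BNot b1 => (bcost N b1).+1
  | BAnd b1 b2 => (bcost N b1 + bcost N b2).+1
  end%N.

Definition mulXT_mem (A : rmem) : rmem := fun a i j =>
  if [&& a == rout, i == 0%N & (j < n)%N]
  then \sum_(l < m) entry l j * A rin 0%N l else A a i j.

Definition evd_mem (A : rmem) (a u l d : nat) : rmem :=
  let: (U, lam) := @evd R sub d (\matrix_(i, j) A a i j) in
  fun a' i j =>
    if (a' == l) && (i == 0%N) && (j < d)%N then
      if insub j is Some j' then lam 0 j' else 0
    else if (a' == u) && (i < d)%N && (j < d)%N then
      if (insub i, insub j) is (Some i', Some j') then U i' j' else 0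
    else A a' i j.

Definition search_mem (search : (R -> R) -> R -> R -> R)
    (N : imem) (A : rmem) x e lo hi : rmem :=
  rput A x 0%N 0%N
    (search (fun t => reval N (rput A x 0%N 0%N t) e) (reval N A lo) (reval N A hi)).

(* Constant factors of the primitives are absorbed in the O( ): an order-d
   eigenvalue decomposition is charged d^3, and a one-dimensional search is
   charged a single evaluation of its objective. *)
Fixpoint exec (c : cmd) (st : config) : config :=
  let N := ints st in
  let A := reals st in
  match c with
  | Skip => st
  | Seq c1 c2 => exec c2 (exec c1 st)
  | SetN a i e =>
      tick (icost i + icost e).+1
        (set_ints (iput N a (ieval N i) (ieval N e)) st)
  | SetR a i j e =>
      tick (icost i + icost j + rcost N e).+1
        (set_reals (rput A a (ieval N i) (ieval N j) (reval N A e)) st)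
  | If b c1 c2 =>
      exec (if beval N A b then c1 else c2) (tick (bcost N b) st)
  | For x b c1 =>
      (* the counter is local: its previous value is restored on exit *)
      let st' := iteri (ieval N b)
        (fun i s => exec c1 (tick 1 (set_ints (iput (ints s) x 0 i) s)))
        (tick (icost b).+1 st) in
      set_ints (iput (ints st') x 0 (N x 0)) st'
  | MulXT => tick TX (set_reals (mulXT_mem A) st)
  | Evd a u l d =>
      tick (icost d + ieval N d ^ 3).+1
        (set_reals (evd_mem A a u l (ieval N d)) st)
  | Bisect x e lo hi =>
      tick (rcost N lo + rcost N hi + rcost N e).+1
        (set_reals (search_mem (@bisect R sub) N A x e lo hi) st)
  | Golden x e lo hi =>
      tick (rcost N lo + rcost N hi + rcost N e).+1
        (set_reals (search_mem (@golden R sub) N A x e lo hi) st)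
  end%N.

Definition init : config := Config (fun _ _ => 0%N) (fun _ _ _ => 0) 0.

Definition run (c : cmd) : config := exec c init.

Definition selected (c : cmd) : {set 'I_n} :=
  [set j : 'I_n | [exists i : 'I_k, ints (run c) out i == j]].

Definition operations (c : cmd) : nat := ops (run c).

End Machine.

(* Textbook product of a dense X^T by a vector, spelled out in scalar
   operations on the entries of X. *)
Definition dense_mulXT : cmd :=
  For 0 IDimN
    (SetR rout (INum 0) (IVar 0)
       (RSum 1 IDimM (RMul (RX (IVar 1) (IVar 0)) (RArr rin (INum 0) (IVar 1))))).

Fixpoint dense (c : cmd) : cmd :=
  match c with
  | Seq c1 c2 => Seq (dense c1) (dense c2)
  | If b c1 c2 => If b (dense c1) (dense c2)
  | For x b c1 => For x b (dense c1)
  | MulXT => dense_mulXT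
  | _ => c
  end.

(* Main.v *)
Require Import Defs.
From HB Require Import structures.
From mathcomp Require Import all_boot all_order all_algebra.
From mathcomp Require Import boolp classical_sets reals.
From mathcomp Require Import ring lra zify.
Import Order.TTheory GRing.Theory Num.Theory.
Local Open Scope ring_scope.
Set Implicit Arguments.
Unset Strict Implicit.
Unset Printing Implicit Defensive.

(** The program is a barrier method in the style of Batson, Spielman and
    Srivastava, run without weights and without repetition of columns.

    Reduction.  An eigendecomposition of X X^T yields P with V = P X and
    V V^T = n I.  If the chosen columns of V satisfy A = sum v v^T >= c I, then
    X_S X_S^T >= (c / n) X X^T as quadratic forms, and this gives
    |X_S^+ x|^2 <= (n / c) |X^+ x|^2 for every vector x
    ([dominated_mpinv]).  A pointwise comparison settles the spectral and the
    Frobenius norm together ([mxnorm_le_pointwise]), so only the least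
    eigenvalue of A matters.

    One round.  Fix a shift and a height H, and let the t-th level be
    b = t shift - m H.  The invariant [barrier] says that A - b is positive
    definite with tr (A - b)^-1 <= 1 / H; it holds with equality for A = 0 at
    t = 0.  Raising b by one shift increases the trace, adding a column v
    decreases it by the Sherman-Morrison formula, and v restores the invariant
    as soon as its score, a combination of the squared coordinates of v in an
    eigenbasis of A, reaches the excess of the trace ([barrier_rank1]).  The
    average score over the columns not yet chosen does so
    ([barrier_average]), because their outer products sum to n I - A; hence
    the column of largest score does, too ([barrier_step]).

    The bound.  The average suffices when
    shift (1 + H) = H + shift^2 / m ([shift_balance]).  After k rounds each
    eigenvalue of A exceeds the last level by at least H, since a single term
    of the trace is at most 1 / H ([potential_gap]).  With
    q = sqrt ((k - 1) m + 1) the best admissible pair gives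
    k shift - m H + H = (q - m + 1)^2 / m ([level_final]), whose quotient into
    n is the sharp factor ([sharp_factorE]); the loose factor is larger
    ([sharp_le_loose]).

    The machine.  The levels are known in closed form, so a round consists of
    one eigendecomposition, of m products with X^T that accumulate the scores
    of all columns, of a maximum over the unused columns and of a rank-one
    update.  Correctness is proved for the effect [mexec] of a command on the
    memory, on which the dense variant agrees with the original
    ([mexec_dense]).  As all loops are bounded by dimensions of the input, the
    running time is bounded by an expression computed from the program text
    ([exec_cost]). *)

(** * Euclidean norms and pseudoinverses *)

Section Norms.
Variable R : realType.

Lemma cauchy_schwarz (I : finType) (a b : I -> R) :
  (\sum_i a i * b i) ^+ 2 <= (\sum_i a i ^+ 2) * (\sum_i b i ^+ 2).
Proof.
set c := \sum_i a i * b i; set p := \sum_i a i ^+ 2; set B := \sum_i b i ^+ 2.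
have p_ge0 : 0 <= p by apply: sumr_ge0 => i _; exact: sqr_ge0.
have [p0|p_neq0] := eqVneq p 0.
  suff -> : c = 0 by rewrite p0 mul0r expr0n.
  apply: big1 => i _; move/eqP: p0; rewrite psumr_eq0 => [|j _]; last exact: sqr_ge0.
  by move=> /allP /(_ i (mem_index_enum _)); rewrite sqrf_eq0 => /eqP ->; rewrite mul0r.
have p_gt0 : 0 < p by rewrite lt0r p_neq0.
have : 0 <= \sum_i (p * b i - c * a i) ^+ 2 by apply: sumr_ge0 => i _; exact: sqr_ge0.
have square u w : \sum_i (u * b i - w * a i) ^+ 2 = u ^+ 2 * B - 2 * u * w * c + w ^+ 2 * p.
  rewrite /B /c /p !mulr_sumr -sumrB -big_split /=.
  by apply: eq_bigr => i _; ring.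
have -> : \sum_i (p * b i - c * a i) ^+ 2 = p * (p * B - c ^+ 2).
  by rewrite square; ring.
by rewrite pmulr_rge0 // subr_ge0.
Qed.

Lemma norm2_ge0 n (x : 'cV[R]_n) : 0 <= norm2 x.
Proof. exact: sqrtr_ge0. Qed.

Lemma norm2_sqr n (x : 'cV[R]_n) : norm2 x ^+ 2 = \sum_i x i 0 ^+ 2.
Proof. by rewrite sqr_sqrtr // sumr_ge0 // => i _; exact: sqr_ge0. Qed.

Lemma norm2_sqr_dot n (x : 'cV[R]_n) : norm2 x ^+ 2 = (x^T *m x) 0 0.
Proof. by rewrite norm2_sqr mxE; apply: eq_bigr => i _; rewrite mxE expr2. Qed.

Lemma norm2_gt0 n (x : 'cV[R]_n) : x != 0 -> 0 < norm2 x ^+ 2.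
Proof.
move=> x_neq0; rewrite lt0r sqr_ge0 andbT norm2_sqr psumr_eq0; last first.
  by move=> i _; exact: sqr_ge0.
apply: contra x_neq0 => /allP x0; apply/eqP/matrixP => i j; rewrite ord1 mxE.
by have := x0 i (mem_index_enum _); rewrite sqrf_eq0 => /eqP.
Qed.

Lemma dot_sqr_le n (x y : 'cV[R]_n) :
  (x^T *m y) 0 0 ^+ 2 <= norm2 x ^+ 2 * norm2 y ^+ 2.
Proof.
rewrite !norm2_sqr; apply: le_trans (cauchy_schwarz _ _).
by rewrite mxE; under eq_bigr do rewrite mxE.
Qed.

Lemma frobenius_norm_sqr m n (A : 'M[R]_(m, n)) :
  frobenius_norm A ^+ 2 = \sum_j norm2 (col j A) ^+ 2.
Proof.
rewrite sqr_sqrtr; last by do 2![apply: sumr_ge0 => ? _]; exact: sqr_ge0.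
rewrite exchange_big; apply: eq_bigr => j _; rewrite norm2_sqr.
by under [RHS]eq_bigr do rewrite mxE.
Qed.

Lemma norm2_mulmx_le m n (A : 'M[R]_(m, n)) x :
  norm2 (A *m x) ^+ 2 <= frobenius_norm A ^+ 2 * norm2 x ^+ 2.
Proof.
rewrite [frobenius_norm A ^+ 2]sqr_sqrtr; last first.
  by do 2![apply: sumr_ge0 => ? _]; exact: sqr_ge0.
rewrite !norm2_sqr mulr_suml; apply: ler_sum => i _.
by rewrite mxE; exact: cauchy_schwarz.
Qed.

Lemma norm2_le_spectral m n (A : 'M[R]_(m, n)) x :
  norm2 x <= 1 -> norm2 (A *m x) <= spectral_norm A.
Proof.
move=> x1; apply: ub_le_sup; last by exists x.
exists (frobenius_norm A) => _ [y /= y1 <-].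
rewrite -ler_sqr ?nnegrE ?norm2_ge0 ?sqrtr_ge0 //.
apply: le_trans (norm2_mulmx_le _ _) _.
by rewrite ler_piMr ?sqr_ge0 // expr_le1 // norm2_ge0.
Qed.

Lemma norm2_0 n : norm2 (0 : 'cV[R]_n) = 0.
Proof. by rewrite /norm2 big1 ?sqrtr0 // => i _; rewrite mxE expr0n. Qed.

Lemma spectral_norm_ge0 m n (A : 'M[R]_(m, n)) : 0 <= spectral_norm A.
Proof.
by apply: le_trans (norm2_ge0 (A *m 0)) _; apply: norm2_le_spectral; rewrite norm2_0.
Qed.

(** Both norms are monotone for the pointwise order of the functions
    |x| -> |A x|, so one pointwise comparison serves for the two of them. *)
Lemma mxnorm_le_pointwise xi m p n (B : 'M[R]_(m, n)) (C : 'M[R]_(p, n)) (kappa : R) :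
  0 <= kappa ->
  (forall x, norm2 (B *m x) ^+ 2 <= kappa * norm2 (C *m x) ^+ 2) ->
  mxnorm xi B ^+ 2 <= kappa * mxnorm xi C ^+ 2.
Proof.
move=> kappa_ge0 leBC; case: xi => /=; last first.
  rewrite !frobenius_norm_sqr mulr_sumr; apply: ler_sum => j _.
  by rewrite !colE.
rewrite -[kappa](sqr_sqrtr kappa_ge0) -exprMn.
have rhs_ge0 : 0 <= Num.sqrt kappa * spectral_norm C.
  by rewrite mulr_ge0 ?sqrtr_ge0 ?spectral_norm_ge0.
rewrite ler_sqr ?nnegrE ?spectral_norm_ge0 //.
apply: ge_sup; first by exists (norm2 (B *m 0)), 0 => //=; rewrite norm2_0.
move=> _ [x /= x1 <-]; apply: (@le_trans _ _ (Num.sqrt kappa * norm2 (C *m x))).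
  rewrite -ler_sqr ?nnegrE ?norm2_ge0 ?mulr_ge0 ?sqrtr_ge0 ?norm2_ge0 //.
  by rewrite exprMn (sqr_sqrtr kappa_ge0).
by rewrite ler_wpM2l ?sqrtr_ge0 // norm2_le_spectral.
Qed.

Lemma mpinv_row_free m n (A : 'M[R]_(m, n)) :
  row_free A -> mpinv A = A^T *m invmx (A *m A^T).
Proof.
move=> Af; have Gu := gram_unitmx Af; apply: (penrose_uniq (mpinvP A)).
set G := A *m A^T in Gu *.
have Gt : (invmx G)^T = invmx G by rewrite trmx_inv trmx_mul trmxK.
have AB : A *m (A^T *m invmx G) = 1%:M by rewrite mulmxA mulmxV.
split; rewrite ?AB ?mul1mx ?trmx1 //.
  by rewrite -[_ *m A *m _]mulmxA AB mulmx1.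
by rewrite !trmx_mul trmxK Gt mulmxA.
Qed.

Section Domination.
Variables (m n p : nat) (X : 'M[R]_(m, n)) (Y : 'M[R]_(m, p)) (alpha : R).
Hypothesis alpha_gt0 : 0 < alpha.
Hypothesis X_free : row_free X.
Hypothesis dominated : forall z,
  alpha * norm2 (X^T *m z) ^+ 2 <= norm2 (Y^T *m z) ^+ 2.

Lemma dominated_row_free : row_free Y.
Proof.
apply/inj_row_free => v vY; apply/eqP; rewrite -(mulmx_free_eq0 v X_free).
apply/eqP/trmx_inj; rewrite trmx0; apply/eqP.
apply: contraT => /norm2_gt0 Xv; have := dominated v^T.
by rewrite -!trmx_mul vY trmx0 norm2_0 expr0n /= leNgt mulr_gt0.
Qed.

(** With y = (Y Y^T)^-1 x and z = (X X^T)^-1 x, the number p = |Y^+ x|^2 is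
    both |Y^T y|^2 and the scalar product of X^T y and X^T z = X^+ x; hence
    p^2 <= |X^T y|^2 |X^+ x|^2 <= (p / alpha) |X^+ x|^2. *)
Lemma dominated_mpinv x :
  norm2 (mpinv Y *m x) ^+ 2 <= alpha^-1 * norm2 (mpinv X *m x) ^+ 2.
Proof.
have Y_free := dominated_row_free.
rewrite !mpinv_row_free // -!mulmxA.
set y := invmx _ *m x; set z := invmx _ *m x.
have Gz : X *m X^T *m z = x by rewrite mulmxA mulmxV ?mul1mx // gram_unitmx.
have Gy : Y *m Y^T *m y = x by rewrite mulmxA mulmxV ?mul1mx // gram_unitmx.
set a := norm2 (Y^T *m y) ^+ 2; set c := norm2 (X^T *m z) ^+ 2.
have aE : a = ((X^T *m y)^T *m (X^T *m z)) 0 0.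
  by rewrite /a norm2_sqr_dot !trmx_mul !trmxK -!mulmxA (mulmxA X) (mulmxA Y) Gz Gy.
have a_ge0 : 0 <= a by exact: sqr_ge0.
have c_ge0 : 0 <= c by exact: sqr_ge0.
have le1 : a ^+ 2 <= norm2 (X^T *m y) ^+ 2 * c by rewrite aE dot_sqr_le.
have le2 : norm2 (X^T *m y) ^+ 2 <= alpha^-1 * a by rewrite ler_pdivlMl // dominated.
have [->|a_neq0] := eqVneq a 0; first by rewrite mulr_ge0 // invr_ge0 ltW.
have a_gt0 : 0 < a by rewrite lt0r a_neq0.
rewrite -(ler_pM2l a_gt0) -expr2; apply: le_trans le1 _.
have -> : a * (alpha^-1 * c) = (alpha^-1 * a) * c by rewrite mulrCA mulrA.
exact: ler_wpM2r.
Qed.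

Lemma dominated_mxnorm_mpinv xi :
  mxnorm xi (mpinv Y) ^+ 2 <= alpha^-1 * mxnorm xi (mpinv X) ^+ 2.
Proof.
by apply: mxnorm_le_pointwise dominated_mpinv; rewrite invr_ge0 ltW.
Qed.
End Domination.
End Norms.

(** * The averaging inequality *)

Section Scalar.
Variable R : realType.

(** What is left of the averaging argument after division by (sum y)^2, where
    the y are the inverses of the gaps between the spectrum and the new level:
    s is the normalized second moment of the y, and a the relative excess of
    the potential.  The difference of the two sides is affine in n, so that
    its slope and its value at n = t + 1 decide.  Both are nonnegative by the
    balance equation of delta, as 1 / m <= s and a H <= s delta. *)
Lemma average_ratio_bound (m n t delta H s a : R) :
  1 <= m -> 0 <= t -> t + 1 <= n ->
  0 < delta -> delta <= 1 -> delta < H ->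
  delta * (1 + H) = H + delta ^+ 2 / m ->
  1 <= m * s -> s <= 1 -> 0 <= a -> a <= 1 -> a * H <= s * delta ->
  H * (1 - a) * (1 + a * (n - t - m))
    <= (n - ((t + 1) * delta - m * H)) * (s - a).
Proof.
move=> m1 t0 tn d0 d1 dH relD ms1 s1 a0 a1 aH.
have m0 : 0 < m by lra.
have H0 : 0 < H by lra.
have s0 : 0 < s by rewrite -(pmulr_rgt0 _ m0); lra.
have rel : m * (delta * (1 + H)) = m * H + delta ^+ 2.
  by rewrite relD mulrDr [m * (_ / _)]mulrC divfK // gt_eqF.
have sa : a <= s.
  rewrite -(ler_pM2r H0); apply: le_trans aH _.
  by rewrite ler_pM2l // ltW.
set u := a * H in aH.
have u0 : 0 <= u by rewrite mulr_ge0 // ltW.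
have sd1 : s * delta <= delta by rewrite ger_pMl.
have slope_ge0 : 0 <= (s - a) - H * (1 - a) * a.
  rewrite -(pmulr_rge0 _ H0).
  have -> : H * (s - a - H * (1 - a) * a) = H * s - u * (1 + H - u).
    by rewrite /u; ring.
  have mono : u * (1 + H - u) <= (s * delta) * (1 + H - s * delta).
    rewrite -subr_ge0.
    have -> : s * delta * (1 + H - s * delta) - u * (1 + H - u) =
              (s * delta - u) * (1 + H - s * delta - u) by ring.
    by apply: mulr_ge0; lra.
  have upper : (s * delta) * (1 + H - s * delta) <= H * s.
    have -> : s * delta * (1 + H - s * delta) =
              s * (delta * (1 + H)) - s ^+ 2 * delta ^+ 2 by ring.
    rewrite relD -subr_ge0.
    have -> : H * s - (s * (H + delta ^+ 2 / m) - s ^+ 2 * delta ^+ 2) =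
              s * delta ^+ 2 * ((m * s - 1) / m) by field; rewrite gt_eqF.
    by rewrite !mulr_ge0 ?invr_ge0 ?sqr_ge0 //; lra.
  by lra.
have least_n : H * (1 - a) * (1 + a - a * m) <= ((t + 1) * (1 - delta) + m * H) * (s - a).
  have first_step : H * (1 - a) * (1 + a - a * m) <= ((1 - delta) + m * H) * (s - a).
    rewrite -(ler_pM2l H0) -subr_ge0.
    have -> : H * ((1 - delta + m * H) * (s - a)) - H * (H * (1 - a) * (1 + a - a * m))
       = (1 - delta) * (s * H - u) + H ^+ 2 * (m * s - 1) - (m - 1) * u ^+ 2.
      by rewrite /u; ring.
    have u2 : u ^+ 2 <= (s * delta) ^+ 2.
      by rewrite ler_sqr ?nnegrE // mulr_ge0 // ltW.
    have le1 : (m - 1) * u ^+ 2 <= (m - 1) * (s * delta) ^+ 2 by rewrite ler_wpM2l //; lra.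
    have le2 : (1 - delta) * (s * H - s * delta) <= (1 - delta) * (s * H - u).
      by rewrite ler_wpM2l; lra.
    suff : 0 <= (1 - delta) * (s * H - s * delta) + H ^+ 2 * (m * s - 1)
                  - (m - 1) * (s * delta) ^+ 2 by lra.
    have key : m * ((1 - delta) * (H - delta)) = (m - 1) * delta ^+ 2.
      have -> : m * ((1 - delta) * (H - delta)) =
        m * H + m * delta ^+ 2 - m * (delta * (1 + H)) by ring.
      by rewrite rel; ring.
    rewrite -(pmulr_rge0 _ m0).
    have -> : m * ((1 - delta) * (s * H - s * delta) + H ^+ 2 * (m * s - 1)
                - (m - 1) * (s * delta) ^+ 2) =
              s * (m * ((1 - delta) * (H - delta))) + m * H ^+ 2 * (m * s - 1)
                - m * (m - 1) * (s * delta) ^+ 2 by ring.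
    rewrite key.
    have -> : s * ((m - 1) * delta ^+ 2) + m * H ^+ 2 * (m * s - 1) -
              m * (m - 1) * (s * delta) ^+ 2 =
              (m * s - 1) * (m * H ^+ 2 - (m - 1) * s * delta ^+ 2) by ring.
    apply: mulr_ge0; first by lra.
    have dH2 : delta ^+ 2 <= H ^+ 2 by rewrite ler_sqr ?nnegrE //; lra.
    have : (m - 1) * s * delta ^+ 2 <= m * delta ^+ 2.
      rewrite ler_wpM2r ?sqr_ge0 //.
      have : (m - 1) * s <= (m - 1) * 1 by rewrite ler_wpM2l //; lra.
      by lra.
    have : m * delta ^+ 2 <= m * H ^+ 2 by rewrite ler_wpM2l //; lra.
    by lra.
  apply: le_trans first_step _; apply: ler_wpM2r; first by lra.
  have : 0 <= t * (1 - delta) by apply: mulr_ge0; lra.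
  by lra.
have : 0 <= (n - t - 1) * ((s - a) - H * (1 - a) * a) by apply: mulr_ge0 => //; lra.
move=> fromn; rewrite -subr_ge0.
have -> : (n - ((t + 1) * delta - m * H)) * (s - a) - H * (1 - a) * (1 + a * (n - t - m))
  = (n - t - 1) * ((s - a) - H * (1 - a) * a)
  + (((t + 1) * (1 - delta) + m * H) * (s - a) - H * (1 - a) * (1 + a - a * m)) by ring.
by lra.
Qed.

Lemma potential_gap (m : nat) (l : 'I_m -> R) (b H : R) :
  0 < H -> (forall i, b < l i) -> \sum_i (l i - b)^-1 <= H^-1 ->
  forall i, b + H <= l i.
Proof.
move=> H0 lb potential i; rewrite -lerBrDl -lef_pV2 ?posrE ?subr_gt0 //.
apply: le_trans potential; rewrite (bigD1 i) //= ler_wpDr //.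
by apply: sumr_ge0 => j _; rewrite invr_ge0 subr_ge0 ltW.
Qed.

(** The squared coordinates of the unused columns along the i-th eigenvector
    sum to n - l i.  The conclusion therefore says that the n - t unused
    columns have an average gain of at least D, the amount by which the
    potential at the new level b' is too large. *)
Lemma barrier_average (m : nat) (l : 'I_m -> R) (n t b b' delta H : R) :
  (0 < m)%N -> 0 <= t -> t + 1 <= n ->
  0 < delta -> delta <= 1 -> delta < H ->
  delta * (1 + H) = H + delta ^+ 2 / m%:R ->
  b' = (t + 1) * delta - m%:R * H -> b' = b + delta ->
  (forall i, b < l i) -> (forall i, l i <= n) ->
  \sum_i (l i - b)^-1 <= H^-1 ->
  let y i := (l i - b')^-1 in
  let D := \sum_i y i - H^-1 in
  is_true (D * (n - t) <= \sum_i (y i ^+ 2 - D * y i) * (n - l i)).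
Proof.
move=> m_gt0 t0 tn d0 d1 dH relD b'E b'b lb ln potential y D.
have H0 : 0 < H by lra.
have m1 : (1 : R) <= m%:R by rewrite ler1n.
have gap i : b' < l i by have := potential_gap H0 lb potential i; rewrite b'b; lra.
have y_gt0 i : 0 < y i by rewrite invr_gt0 subr_gt0.
set Y := \sum_i y i; set S2 := \sum_i y i ^+ 2.
have Y_gt0 : 0 < Y.
  rewrite /Y (bigD1 (Ordinal m_gt0)) //= ltr_pwDl ?y_gt0 //.
  by apply: sumr_ge0 => j _; exact: ltW.
have [D_le0|D_gt0] := leP D 0.
  apply: (@le_trans _ _ 0); first by rewrite mulr_le0_ge0 //; lra.
  apply: sumr_ge0 => i _; apply: mulr_ge0; last by rewrite subr_ge0.
  by rewrite addr_ge0 ?sqr_ge0 // -mulNr mulr_ge0 // ?oppr_ge0 // ltW.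
have le_mS : Y ^+ 2 <= m%:R * S2.
  have := cauchy_schwarz (fun _ : 'I_m => 1) y.
  under eq_bigr do rewrite mul1r.
  by under [X in _ <= X * _]eq_bigr do rewrite expr1n; rewrite sumr_const card_ord.
have le_SY : S2 <= Y ^+ 2.
  rewrite [Y ^+ 2]expr2 {1}/Y mulr_suml; apply: ler_sum => i _.
  rewrite expr2 ler_wpM2l ?(ltW (y_gt0 i)) // /Y (bigD1 i) //= lerDl.
  by apply: sumr_ge0 => j _; exact: ltW.
(* Cauchy-Schwarz for the products of (l i - b)^(-1/2) and (l i - b)^(1/2) y i,
   where (l i - b) (y i)^2 = y i + delta (y i)^2. *)
have le_H : H * Y ^+ 2 <= Y + delta * S2.
  pose e i := Num.sqrt (l i - b); pose f i := y i * e i.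
  have e_neq0 i : l i - b != 0 by rewrite subr_eq0 gt_eqF.
  have eE i : e i ^+ 2 = l i - b by rewrite sqr_sqrtr // subr_ge0 ltW.
  have e0 i : e i != 0 by rewrite -sqrf_eq0 eE.
  have := cauchy_schwarz (fun i => (e i)^-1) f.
  have -> : \sum_i (e i)^-1 * f i = Y.
    by apply: eq_bigr => i _; rewrite /f mulrC mulfK.
  have -> : \sum_i (e i)^-1 ^+ 2 = \sum_i (l i - b)^-1.
    by apply: eq_bigr => i _; rewrite exprVn eE.
  have -> : \sum_i f i ^+ 2 = Y + delta * S2.
    rewrite /Y /S2 mulr_sumr -big_split; apply: eq_bigr => i _ /=.
    rewrite /f exprMn eE /y b'b; field.
    by move: (gap i); rewrite b'b => gapi; rewrite gt_eqF //; lra.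
  move=> CS; rewrite -ler_pdivlMl //; apply: le_trans CS _.
  rewrite ler_wpM2r // addr_ge0 ?ltW // mulr_gt0 // /S2 (bigD1 (Ordinal m_gt0)) //=.
  by rewrite ltr_pwDl ?exprn_gt0 // sumr_ge0 // => j _; exact: sqr_ge0.
have Y2_gt0 : 0 < Y ^+ 2 by rewrite exprn_gt0.
have Y_neq0 : Y != 0 by rewrite gt_eqF.
pose s := S2 / Y ^+ 2; pose a := D / Y.
have S2E : S2 = s * Y ^+ 2 by rewrite divfK // gt_eqF.
have DE : D = a * Y by rewrite divfK.
have HVE : H^-1 = (1 - a) * Y by rewrite mulrBl mul1r -DE /D -/Y subKr.
have YH : Y * (H * (1 - a)) = 1.
  by rewrite mulrCA [Y * _]mulrC -HVE divff // gt_eqF.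
have aH : a * H <= s * delta.
  rewrite -(ler_pM2r Y2_gt0) [s * delta]mulrC -[delta * s * _]mulrA -S2E.
  have -> : a * H * Y ^+ 2 = H * Y ^+ 2 - Y * (Y * (H * (1 - a))) by ring.
  by rewrite YH; lra.
have sumE : \sum_i (y i ^+ 2 - D * y i) * (n - l i)
            = (n - b') * (S2 - D * Y) - Y + D * m%:R.
  transitivity (\sum_i ((n - b') * (y i ^+ 2 - D * y i) - y i + D)).
    apply: eq_bigr => i _; have : y i * (l i - b') = 1.
      by rewrite mulVf // subr_eq0 gt_eqF.
    move=> yl; transitivity
      ((n - b') * (y i ^+ 2 - D * y i) - (y i - D) * (y i * (l i - b'))); first by ring.
    by rewrite yl; ring.
  rewrite 2!big_split /= sumrN -mulr_sumr sumrB -mulr_sumr sumr_const card_ord.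
  by rewrite (mulr_natr D m).
have := @average_ratio_bound m%:R n t delta H s a m1 t0 tn d0 d1 dH relD.
have ms1 : 1 <= m%:R * s by rewrite -(ler_pM2r Y2_gt0) mul1r -mulrA -S2E.
have s1 : s <= 1 by rewrite -(ler_pM2r Y2_gt0) mul1r -S2E.
have a0 : 0 <= a by rewrite divr_ge0 // ltW.
have a1 : a <= 1.
  by rewrite -(ler_pM2r Y_gt0) mul1r -DE /D gerBl invr_ge0 ltW.
move=> /(_ ms1 s1 a0 a1 aH); rewrite -b'E -(ler_pM2r Y2_gt0).
have -> : H * (1 - a) * (1 + a * (n - t - m%:R)) * Y ^+ 2 =
  (Y * (H * (1 - a))) * (Y + (a * Y) * (n - t - m%:R)) by ring.
have -> : (n - b') * (s - a) * Y ^+ 2 = (n - b') * (s * Y ^+ 2 - (a * Y) * Y) by ring.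
rewrite YH -S2E -DE sumE mul1r => main.
by lra.
Qed.
End Scalar.

(** * Positive definiteness and rank-one updates *)

Section Barrier.
Variable R : realType.

Definition posdef m (M : 'M[R]_m) :=
  forall x : 'cV_m, x != 0 -> 0 < (x^T *m M *m x) 0 0.

(** The trace of (A - b)^-1 explodes when b approaches the least eigenvalue of A;
    its bound 1 / H keeps the whole spectrum at distance at least H above b. *)
Definition barrier m (A : 'M[R]_m) (b H : R) :=
  posdef (A - b%:M) /\ \tr (invmx (A - b%:M)) <= H^-1.

Lemma invmx_unique m (M N : 'M[R]_m) : M *m N = 1%:M -> invmx M = N.
Proof.
move=> MN1; have [Mu _] := mulmx1_unit MN1.
by rewrite -[LHS]mulmx1 -MN1 mulmxA mulVmx // mul1mx.
Qed.

Lemma scalar_mx11 (M : 'M[R]_1) : M = (M 0 0)%:M.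
Proof. by apply/matrixP => i j; rewrite !ord1 mxE eqxx mulr1n. Qed.

Section Eigen.
Variables (m : nat) (U : 'M[R]_m).
Hypothesis UU : U *m U^T = 1%:M.

Let UtU : U^T *m U = 1%:M. Proof. exact: mulmx1C. Qed.

Definition spectral_mx (d : 'I_m -> R) := U *m diag_mx (\row_i d i) *m U^T.

Lemma spectral_mxE l : U *m diag_mx l *m U^T = spectral_mx (fun i => l 0 i).
Proof.
by rewrite /spectral_mx; congr (_ *m diag_mx _ *m _); apply/rowP => i; rewrite mxE.
Qed.

Lemma spectral_mxM d e : spectral_mx d *m spectral_mx e = spectral_mx (fun i => d i * e i).
Proof.
rewrite /spectral_mx !mulmxA -[_ *m U^T *m U]mulmxA UtU mulmx1.
rewrite -[U *m _ *m diag_mx _]mulmxA mulmx_diag; congr (_ *m diag_mx _ *m _).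
by apply/rowP => i; rewrite !mxE.
Qed.

Lemma spectral_mx_const c : spectral_mx (fun=> c) = c%:M.
Proof.
rewrite /spectral_mx (_ : \row_i c = const_mx c); last by apply/rowP => i; rewrite !mxE.
by rewrite diag_const_mx mul_mx_scalar -scalemxAl UU scalemx1.
Qed.

Lemma spectral_mx_shift d c : spectral_mx d - c%:M = spectral_mx (fun i => d i - c).
Proof.
rewrite -spectral_mx_const /spectral_mx -mulmxBl -mulmxBr; congr (_ *m _ *m _).
apply/matrixP => i j; rewrite !mxE; case: eqP => [->|_]; first by rewrite !mulr1n.
by rewrite !mulr0n subr0.
Qed.

Lemma spectral_mx_inv d : (forall i, d i != 0) ->
  invmx (spectral_mx d) = spectral_mx (fun i => (d i)^-1).
Proof.
move=> d_neq0; apply: invmx_unique; rewrite spectral_mxM -spectral_mx_const.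
rewrite /spectral_mx; congr (_ *m diag_mx _ *m _); apply/rowP => i.
by rewrite !mxE divff.
Qed.

Lemma spectral_mx_tr d : \tr (spectral_mx d) = \sum_i d i.
Proof.
rewrite /spectral_mx -mulmxA mxtrace_mulC -mulmxA UtU mulmx1 mxtrace_diag.
by apply: eq_bigr => i _; rewrite mxE.
Qed.

Lemma spectral_mx_form d (x : 'cV_m) :
  (x^T *m spectral_mx d *m x) 0 0 = \sum_i d i * (U^T *m x) i 0 ^+ 2.
Proof.
have -> : x^T *m spectral_mx d *m x = (U^T *m x)^T *m diag_mx (\row_i d i) *m (U^T *m x).
  by rewrite /spectral_mx trmx_mul trmxK !mulmxA.
rewrite mul_mx_diag mxE; apply: eq_bigr => i _; rewrite !mxE.
by rewrite mulrC mulrA -expr2 mulrC.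
Qed.

Lemma spectral_mx_posdef d : posdef (spectral_mx d) <-> forall i, 0 < d i.
Proof.
split=> [dpos i|dpos x x_neq0].
  have /dpos : U *m delta_mx i 0 != 0 :> 'cV_m.
    apply: contraTneq isT => Ue0.
    have /matrixP/(_ i 0) : U^T *m (U *m delta_mx i 0) = 0 :> 'cV_m by rewrite Ue0 mulmx0.
    rewrite mulmxA UtU mul1mx !mxE !eqxx => /eqP.
    by rewrite oner_eq0.
  rewrite spectral_mx_form mulmxA UtU mul1mx (bigD1 i) //= big1 => [|j ji].
    by rewrite mxE !eqxx expr1n mulr1 addr0.
  by rewrite mxE (negbTE ji) expr0n mulr0.
have Ux_neq0 : U^T *m x != 0.
  apply: contra x_neq0 => /eqP Ux0.
  by rewrite -[x]mul1mx -UU -mulmxA Ux0 mulmx0.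
rewrite spectral_mx_form lt0r sumr_ge0 ?andbT => [|i _]; last first.
  by rewrite mulr_ge0 ?sqr_ge0 // ltW.
rewrite psumr_eq0 => [|i _]; last by rewrite mulr_ge0 ?sqr_ge0 // ltW.
apply: contra Ux_neq0 => /allP all0; apply/eqP/colP => i; rewrite [RHS]mxE.
have := all0 i (mem_index_enum _).
by rewrite mulf_eq0 gt_eqF //= sqrf_eq0 => /eqP.
Qed.

Lemma spectral_barrier d b H : (0 < m)%N ->
  barrier (spectral_mx d) b H ->
  (forall i, b < d i) /\ \sum_i (d i - b)^-1 <= H^-1.
Proof.
move=> m_gt0 []; rewrite spectral_mx_shift => /spectral_mx_posdef dpos.
have db i : b < d i by rewrite -subr_gt0.
by rewrite spectral_mx_inv ?spectral_mx_tr // => i; rewrite gt_eqF.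
Qed.
End Eigen.

Lemma sherman_morrison m (M N : 'M[R]_m) (v : 'cV_m) :
  M *m N = 1%:M -> 1 + (v^T *m N *m v) 0 0 != 0 ->
  invmx (M + v *m v^T) =
  N - (1 + (v^T *m N *m v) 0 0)^-1 *: (N *m v *m (v^T *m N)).
Proof.
set c := (v^T *m N *m v) 0 0 => MN1 c_neq0; apply: invmx_unique.
have vNv : v^T *m N *m v = c%:M by exact: scalar_mx11.
set w := v *m (v^T *m N).
have e1 : M *m (N *m v *m (v^T *m N)) = w by rewrite !mulmxA MN1 mul1mx /w !mulmxA.
have e2 : v *m v^T *m (N *m v *m (v^T *m N)) = c *: w.
  rewrite -!mulmxA (mulmxA v^T) (mulmxA (v^T *m N)) vNv mul_scalar_mx.
  by rewrite -scalemxAr.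
rewrite mulmxDl !mulmxBr MN1 -!scalemxAr e1 e2 -[v *m v^T *m N]mulmxA -/w.
rewrite scalerA -addrA -[RHS]addr0; congr (_ + _).
have -> : - ((1 + c)^-1 *: w) + (w - ((1 + c)^-1 * c) *: w) =
          (1 - (1 + c)^-1 * (1 + c)) *: w.
  by rewrite (mulrDr _ 1 c) mulr1 scalerBl scale1r scalerDl opprD addrCA.
by rewrite mulVf // subrr scale0r.
Qed.

Lemma mxtrace_outer m (x y : 'cV[R]_m) : \tr (x *m y^T) = (y^T *m x) 0 0.
Proof. by rewrite mxtrace_mulC {1}[y^T *m x]scalar_mx11 mxtrace_scalar mulr1n. Qed.

(** By the Sherman-Morrison formula the rank-one term lowers the potential by
    the quotient of sum (y i)^2 (z i)^2 and 1 + sum (y i) (z i)^2; clearing the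
    denominator turns the requirement that this be at least D into the
    hypothesis. *)
Lemma barrier_rank1 m (U : 'M[R]_m) d b' H (v : 'cV_m) :
  U *m U^T = 1%:M -> (forall i, b' < d i) ->
  let y i := (d i - b')^-1 in
  let D := \sum_i y i - H^-1 in
  let z := U^T *m v in
  D <= \sum_i (y i ^+ 2 - D * y i) * z i 0 ^+ 2 ->
  barrier (spectral_mx U d + v *m v^T) b' H.
Proof.
move=> UU db y D z gain.
have y_gt0 i : 0 < y i by rewrite invr_gt0 subr_gt0.
rewrite /barrier addrAC spectral_mx_shift //; set M := spectral_mx U _.
set N := spectral_mx U y.
have MN1 : M *m N = 1%:M.
  rewrite spectral_mxM // -(spectral_mx_const UU) /spectral_mx.
  congr (_ *m diag_mx _ *m _); apply/rowP => i; rewrite !mxE /y divff //.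
  by rewrite subr_eq0 gt_eqF.
set c := (v^T *m N *m v) 0 0; have cE : c = \sum_i y i * z i 0 ^+ 2 by exact: spectral_mx_form.
have c_ge0 : 0 <= c by rewrite cE sumr_ge0 // => i _; rewrite mulr_ge0 ?sqr_ge0 // ltW.
have c1_gt0 : 0 < 1 + c by rewrite ltr_pwDl.
split.
  move=> x x_neq0; rewrite mulmxDr mulmxDl mxE ltr_pwDl //.
    by move: x x_neq0; apply/spectral_mx_posdef => // i; rewrite subr_gt0.
  have -> : x^T *m (v *m v^T) *m x = (v^T *m x)^T *m (v^T *m x).
    by rewrite trmx_mul trmxK !mulmxA.
  by rewrite -norm2_sqr_dot sqr_ge0.
rewrite (sherman_morrison MN1) ?gt_eqF // linearB linearZ /=.
have -> : \tr (N *m v *m (v^T *m N)) = \sum_i y i ^+ 2 * z i 0 ^+ 2.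
  rewrite mulmxA mxtrace_mulC (mulmxA N _ v^T) (mulmxA N N) spectral_mxM //.
  rewrite mxtrace_outer (mulmxA v^T).
  rewrite spectral_mx_form; apply: eq_bigr => i _.
  by rewrite expr2.
rewrite spectral_mx_tr // -/c lerBlDr -lerBlDl -/D ler_pdivlMl //.
have gainE : \sum_i (y i ^+ 2 - D * y i) * z i 0 ^+ 2 =
    \sum_i y i ^+ 2 * z i 0 ^+ 2 - D * c.
  by rewrite cE mulr_sumr -sumrB; apply: eq_bigr => i _; rewrite mulrBl mulrA.
by move: gain; rewrite gainE lerBrDr (mulrDl 1 c D) mul1r (mulrC c D).
Qed.
End Barrier.

(** * The levels of the barrier *)

Section Levels.
Variables (R : realType) (m k : nat).
Hypotheses (m_gt0 : (0 < m)%N) (le_mk : (m <= k)%N).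

Definition qpar : R := Num.sqrt ((k%:R - 1) * m%:R + 1).
Definition rpar : R := qpar - m%:R + 1.
(** Among the pairs that satisfy shift_balance with a shift of at most 1, this
    one maximizes level k + height, the final bound on the spectrum. *)
Definition shift : R := rpar / qpar.
Definition height : R := rpar * (qpar + 1) / (m%:R * qpar).
Definition level (t : nat) : R := t%:R * shift - m%:R * height.

Lemma dim_ge1 : (1 : R) <= m%:R.
Proof. by rewrite ler1n. Qed.
Lemma dim_le_size : (m%:R : R) <= k%:R.
Proof. by rewrite ler_nat. Qed.

Lemma qpar_sqr : qpar ^+ 2 = (k%:R - 1) * m%:R + 1.
Proof.
have m1 := dim_ge1; have mk := dim_le_size.
by rewrite sqr_sqrtr // addr_ge0 // mulr_ge0 ?ler0n //; lra.
Qed.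

Lemma qpar_ge1 : 1 <= qpar.
Proof.
have m1 := dim_ge1; have mk := dim_le_size.
rewrite -(@ler_sqr _ 1) ?nnegrE ?sqrtr_ge0 // expr1n qpar_sqr.
by rewrite lerDr mulr_ge0 //; lra.
Qed.

Lemma rpar_gt0 : 0 < rpar.
Proof.
have m1 := dim_ge1; have mk := dim_le_size.
rewrite /rpar addrAC -addrA -opprB subr_gt0.
rewrite -ltr_sqr ?nnegrE ?subr_ge0 ?sqrtr_ge0 // qpar_sqr.
have : (m%:R - 1) * m%:R <= (k%:R - 1) * m%:R :> R by rewrite ler_wpM2r //; lra.
by lra.
Qed.

Lemma shift_gt0 : 0 < shift.
Proof. by rewrite divr_gt0 ?rpar_gt0 // (lt_le_trans ltr01 qpar_ge1). Qed.

Lemma shift_le1 : shift <= 1.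
Proof.
have m1 := dim_ge1; have mk := dim_le_size.
rewrite ler_pdivrMr ?(lt_le_trans ltr01 qpar_ge1) // mul1r /rpar; lra.
Qed.

Lemma height_sub_shift : height - shift = rpar ^+ 2 / (m%:R * qpar).
Proof.
have m1 := dim_ge1; have mk := dim_le_size.
have := qpar_ge1; rewrite /height /shift => q1.
by rewrite /rpar; field; rewrite !gt_eqF //; lra.
Qed.

Lemma lt_shift_height : shift < height.
Proof.
have m1 := dim_ge1; have mk := dim_le_size.
have := qpar_ge1 => q1; rewrite -subr_gt0 height_sub_shift divr_gt0 ?exprn_gt0 ?rpar_gt0 //.
by rewrite mulr_gt0 //; lra.
Qed.

(** The usual barrier argument has shift (1 + height) = height.  The summand
    shift^2 / m stems from the inequality (sum y)^2 <= m sum y^2 between the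
    inverse gaps of the m eigenvalues, and it accounts for the difference
    between the loose and the sharp factor. *)
Lemma shift_balance : shift * (1 + height) = height + shift ^+ 2 / m%:R.
Proof.
have m1 := dim_ge1; have mk := dim_le_size.
have := qpar_ge1; rewrite /height /shift /rpar => q1.
by field; rewrite !gt_eqF //; lra.
Qed.

Lemma level_final : level k + height = rpar ^+ 2 / m%:R.
Proof.
have m1 := dim_ge1; have mk := dim_le_size.
have q1 := qpar_ge1.
have kE : k%:R = (qpar ^+ 2 - 1) / m%:R + 1 :> R.
  by rewrite qpar_sqr addrK mulfK ?subrK // gt_eqF //; lra.
rewrite /level kE /height /shift /rpar.
by field; rewrite !gt_eqF //; lra.
Qed.

Lemma sharp_factorE n : sharp_factor R m n k = n%:R * m%:R / rpar ^+ 2.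
Proof.
have m1 := dim_ge1; have mk := dim_le_size.
rewrite /sharp_factor -/qpar; have q1 := qpar_ge1.
have r0 := rpar_gt0.
case: ifP => [/andP[/eqP m_1 /eqP k_1]|].
  have -> : rpar = 1 by rewrite /rpar /qpar m_1 k_1 subrr mul0r add0r sqrtr1; lra.
  by rewrite m_1 expr1n divr1 mulr1.
move=> mk1; have k1 : (1 : R) < k%:R.
  rewrite ltr1n ltn_neqAle (leq_trans m_gt0 le_mk) andbT eq_sym.
  apply: contraFN mk1 => /eqP k_1; rewrite k_1 eqxx andbT eqn_leq m_gt0 andbT.
  by rewrite -k_1.
have q2 := qpar_sqr.
have kqE : (k%:R - qpar) * (qpar + 1) = (k%:R - 1) * rpar.
  have -> : (k%:R - qpar) * (qpar + 1) = k%:R * qpar + k%:R - qpar ^+ 2 - qpar by ring.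
  by rewrite q2 /rpar; ring.
have q_lt_k : 0 < k%:R - qpar.
  have : 0 < (k%:R - qpar) * (qpar + 1) by rewrite kqE mulr_gt0 //; lra.
  by rewrite pmulr_lgt0 //; lra.
have -> : (qpar - 1) / (qpar - k%:R) = - (m%:R / rpar).
  apply/eqP; rewrite -subr_eq0 opprK.
  have -> : (qpar - 1) / (qpar - k%:R) + m%:R / rpar =
     ((qpar - 1) * rpar + m%:R * (qpar - k%:R)) / ((qpar - k%:R) * rpar).
    by field; rewrite (gt_eqF r0) lt_eqF //; lra.
  have : (qpar + 1) * ((qpar - 1) * rpar + m%:R * (qpar - k%:R)) = 0.
    have -> : (qpar + 1) * ((qpar - 1) * rpar + m%:R * (qpar - k%:R)) =
      (qpar ^+ 2 - 1) * rpar - m%:R * ((k%:R - qpar) * (qpar + 1)) by ring.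
    by rewrite kqE q2; ring.
  move=> /eqP; rewrite mulf_eq0 gt_eqF /=; last by lra.
  by move=> /eqP ->; rewrite mul0r.
by field; rewrite !gt_eqF //; lra.
Qed.

(** With s, w, p the square roots of k, m - 1, m, the claim reads
    p (s - w) <= q - w^2.  As q^2 = (p s)^2 - w^2 and p^2 - w^2 = 1, the
    differences p s - q = w^2 / (p s + q) and p w - w^2 = w / (p + w) compare. *)
Lemma sharp_le_loose n : sharp_factor R m n k <= loose_factor R m n k.
Proof.
have m1 := dim_ge1; have mk := dim_le_size.
rewrite sharp_factorE /loose_factor -mulrA ler_wpM2l ?ler0n //.
have r0 := rpar_gt0; have q1 := qpar_ge1.
set s := Num.sqrt k%:R; set w := Num.sqrt (m%:R - 1).
pose p : R := Num.sqrt m%:R.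
have s2 : s ^+ 2 = k%:R by rewrite sqr_sqrtr ?ler0n.
have p2 : p ^+ 2 = m%:R by rewrite sqr_sqrtr ?ler0n.
have w2 : w ^+ 2 = m%:R - 1 by rewrite sqr_sqrtr ?subr_ge0.
have w0 : 0 <= w by exact: sqrtr_ge0.
have s0 : 0 <= s by exact: sqrtr_ge0.
have p0 : 0 < p by rewrite sqrtr_gt0; lra.
have ps : p <= s by rewrite ler_sqrt ?ler0n.
have wp : w < p by rewrite ltr_sqrt; lra.
have q_ge : w ^+ 2 <= qpar by rewrite w2; move: r0; rewrite /rpar; lra.
have q2 : qpar ^+ 2 = (p * s) ^+ 2 - w ^+ 2 by rewrite exprMn p2 s2 w2 qpar_sqr; ring.
have e1 : (p * s - qpar) * (p * s + qpar) = w ^+ 2.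
  by transitivity ((p * s) ^+ 2 - qpar ^+ 2); [ring|rewrite q2; ring].
have pw : (p * w - w ^+ 2) * (p + w) = w.
  transitivity (w * (p ^+ 2 - w ^+ 2)); first by ring.
  by rewrite p2 w2; ring.
have main : p * (s - w) <= rpar.
  have -> : rpar = qpar - w ^+ 2 by rewrite w2 /rpar; ring.
  suff : p * s - qpar <= p * w - w ^+ 2 by lra.
  have den : 0 < p * s + qpar by rewrite ltr_wpDl ?mulr_ge0 //; lra.
  have w2E : w ^+ 2 = (p * w - w ^+ 2) * (w * (p + w)) by rewrite mulrCA pw.
  have d0 : 0 <= p * w - w ^+ 2 by rewrite expr2 -mulrBl mulr_ge0 //; lra.
  rewrite -(ler_pM2r den) e1 [leLHS]w2E; apply: ler_wpM2l => //.
  have : p * w <= p * s by rewrite ler_wpM2l //; lra.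
  have -> : w * (p + w) = p * w + w ^+ 2 by ring.
  by lra.
have sw0 : 0 < s - w by lra.
rewrite -[m%:R]p2 ler_pdivrMr ?exprn_gt0 // ler_pdivlMl ?exprn_gt0 //.
rewrite mulrC -exprMn.
have ps0 : 0 <= p * (s - w) by rewrite mulr_ge0 //; lra.
by rewrite ler_sqr ?nnegrE // ltW.
Qed.
End Levels.

(** * Adding a column *)

Lemma mulmx_col (R : realType) m n p (A : 'M[R]_(m, n)) (B : 'M[R]_(n, p)) j :
  col j (A *m B) = A *m col j B.
Proof. by rewrite !colE mulmxA. Qed.

Section Selection.
Variables (R : realType) (m n k : nat) (V : 'M[R]_(m, n)).
Hypotheses (m_gt0 : (0 < m)%N) (le_mk : (m <= k)%N).
Hypothesis V_tight : V *m V^T = n%:R%:M.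

Local Notation delta := (shift R m k).
Local Notation H := (height R m k).
Local Notation level := (level R m k).

Definition outer_sum (S : {set 'I_n}) : 'M[R]_m :=
  \sum_(j in S) col j V *m (col j V)^T.

Lemma outer_sumE S a b : outer_sum S a b = \sum_(j in S) V a j * V b j.
Proof.
rewrite summxE; apply: eq_bigr => j _.
by rewrite mxE big_ord1 !mxE.
Qed.

Lemma outer_sum_sym S : (outer_sum S)^T = outer_sum S.
Proof.
by apply/matrixP => a b; rewrite mxE !outer_sumE; apply: eq_bigr => j _; rewrite mulrC.
Qed.

Lemma outer_sum_setU1 (S : {set 'I_n}) j : j \notin S ->
  outer_sum (j |: S) = outer_sum S + col j V *m (col j V)^T.
Proof. by move=> jS; rewrite /outer_sum big_setU1 //= addrC. Qed.

Lemma outer_sum_form S (x : 'cV_m) :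
  (x^T *m outer_sum S *m x) 0 0 = \sum_(j in S) (V^T *m x) j 0 ^+ 2.
Proof.
rewrite /outer_sum mulmx_sumr mulmx_suml summxE; apply: eq_bigr => j _.
have -> : x^T *m (col j V *m (col j V)^T) *m x = ((col j V)^T *m x)^T *m ((col j V)^T *m x).
  by rewrite trmx_mul trmxK !mulmxA.
rewrite mxE big_ord1 mxE -expr2; congr (_ ^+ 2).
by rewrite tr_col -row_mul mxE.
Qed.

(** With A = 0 the trace of (m H)^-1 I is exactly 1 / H. *)
Lemma barrier_init : barrier (outer_sum finset.set0) (level 0) H.
Proof.
have H0 : 0 < H := lt_trans (shift_gt0 R m_gt0 le_mk) (lt_shift_height R m_gt0 le_mk).
have m0 : (0 : R) < m%:R by rewrite ltr0n.
have U1 : 1%:M *m (1%:M)^T = 1%:M :> 'M[R]_m by rewrite trmx1 mulmx1.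
have -> : outer_sum finset.set0 = spectral_mx 1%:M (fun=> 0).
  by rewrite /outer_sum big_set0 spectral_mx_const // raddf0.
rewrite /barrier spectral_mx_shift // /level mul0r !sub0r opprK.
split; first by apply/spectral_mx_posdef => // i; exact: mulr_gt0.
rewrite spectral_mx_inv // => [|i]; last by apply: lt0r_neq0; exact: mulr_gt0.
rewrite spectral_mx_tr // sumr_const card_ord -[X in X <= _]mulr_natl invfM mulrA divff ?mul1r //.
by rewrite gt_eqF.
Qed.

Definition potential_excess (d : 'I_m -> R) (b : R) : R := \sum_i (d i - b)^-1 - H^-1.

Definition weight (d : 'I_m -> R) (b : R) (i : 'I_m) : R :=
  (d i - b)^-1 ^+ 2 - potential_excess d b * (d i - b)^-1.

(** The quantity that barrier_rank1 compares with the excess, for the j-th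
    column of V. *)
Definition score (U : 'M[R]_m) (d : 'I_m -> R) (b : R) (j : 'I_n) : R :=
  \sum_i weight d b i * (U^T *m V) i j ^+ 2.

(** A column whose score is maximal among the unused ones reaches their average,
    which is at least the excess by barrier_average. *)
Lemma barrier_step (S : {set 'I_n}) U d j :
  U *m U^T = 1%:M -> outer_sum S = spectral_mx U d ->
  barrier (outer_sum S) (level #|S|) H ->
  j \notin S ->
  (forall j', j' \notin S -> score U d (level #|S|.+1) j' <= score U d (level #|S|.+1) j) ->
  barrier (outer_sum (j |: S)) (level #|j |: S|) H.
Proof.
move=> UU SE bar jS jmax; rewrite cardsU1 jS outer_sum_setU1 // SE.
have d0 := shift_gt0 R m_gt0 le_mk.
have dH := lt_shift_height R m_gt0 le_mk.
have H0 := lt_trans d0 dH.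
move: bar; rewrite SE => /(spectral_barrier UU m_gt0) [lb potential].
set t := #|S| in jmax lb potential *; rewrite add1n.
set b' := level t.+1.
have b'E : b' = (t%:R + 1) * delta - m%:R * H by rewrite /b' /level -natr1.
have b'b : b' = level t + delta by rewrite b'E /level; ring.
have gap := potential_gap H0 lb potential.
pose z := U^T *m V.
have UtU : U^T *m U = 1%:M by exact: mulmx1C.
have zS i : \sum_(j in S) z i j ^+ 2 = d i.
  transitivity ((U^T *m outer_sum S *m U) i i).
    have -> : U^T *m outer_sum S *m U = \sum_(j in S) (U^T *m col j V) *m (U^T *m col j V)^T.
      rewrite /outer_sum mulmx_sumr mulmx_suml; apply: eq_bigr => j' _.
      by rewrite trmx_mul trmxK !mulmxA.
    rewrite summxE; apply: eq_bigr => j' _.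
    by rewrite [RHS]mxE big_ord1 [_^T _ _]mxE -mulmx_col [col _ _ _ _]mxE -expr2.
  by rewrite SE /spectral_mx !mulmxA UtU mul1mx -mulmxA UtU mulmx1 !mxE eqxx mulr1n.
have zT i : \sum_j z i j ^+ 2 = n%:R.
  transitivity ((z *m z^T) i i).
    by rewrite [RHS]mxE; apply: eq_bigr => j' _; rewrite [z^T _ _]mxE expr2.
  rewrite /z trmx_mul trmxK mulmxA -[U^T *m V *m _]mulmxA V_tight mul_mx_scalar.
  by rewrite -scalemxAl UtU !mxE eqxx mulr1.
have zC i : \sum_(j | j \notin S) z i j ^+ 2 = n%:R - d i.
  by have := zT i; rewrite (bigID (mem S)) /= zS => <-; rewrite addrAC subrr add0r.
have dn i : d i <= n%:R.
  by rewrite -subr_ge0 -zC sumr_ge0 // => j' _; exact: sqr_ge0.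
have card_unused : #|[pred j | j \notin S]| = (n - t)%N.
  by rewrite -[n in RHS]card_ord -(cardC (mem S)) addKn; apply: eq_card.
have tn : (t < n)%N.
  by rewrite -subn_gt0 -card_unused; apply/card_gt0P; exists j.
have := @barrier_average R m d n%:R t%:R (level t) b' delta H m_gt0 (ler0n _ _) _ d0
  (shift_le1 R m_gt0 le_mk) dH (shift_balance R m_gt0 le_mk) b'E b'b lb dn potential.
rewrite natr1 ler_nat => /(_ tn); cbv zeta; rewrite -/(potential_excess d b').
move=> average; apply: barrier_rank1 => // [i|]; cbv zeta; rewrite -/(potential_excess d b').
  by apply: lt_le_trans (gap i); rewrite b'b ltrD2l.
have nt0 : (0 : R) < n%:R - t%:R by rewrite subr_gt0 ltr_nat.
rewrite -(ler_pM2r nt0); apply: le_trans average _.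
have -> : \sum_i ((d i - b')^-1 ^+ 2 - potential_excess d b' * (d i - b')^-1) * (n%:R - d i) =
          \sum_(j' | j' \notin S) score U d b' j'.
  rewrite /score exchange_big; apply: eq_bigr => i _ /=.
  by rewrite -zC mulr_sumr.
apply: (@le_trans _ _ (\sum_(j' | j' \notin S) score U d b' j)).
  by apply: ler_sum => j' /jmax.
rewrite sumr_const card_unused -[leLHS]mulr_natr natrB ?(ltnW tn) //.
rewrite ler_pM2r // le_eqVlt; apply/orP; left; apply/eqP.
by apply: eq_bigr => i _; rewrite -mulmx_col [in RHS]mxE.
Qed.

End Selection.

(** * Whitening *)

Section Whitening.
Variables (R : realType) (m n : nat) (X : 'M[R]_(m, n)) (W : 'M[R]_m) (g : 'I_m -> R).
Hypotheses (n_gt0 : (0 < n)%N) (X_free : row_free X).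
Hypotheses (WW : W *m W^T = 1%:M) (gramE : X *m X^T = spectral_mx W g).

Definition whitening : 'M[R]_m := \matrix_(i, j) (Num.sqrt (n%:R / g i) * W j i).

Lemma gram_eigenvalue_gt0 i : 0 < g i.
Proof.
move: i; apply/(spectral_mx_posdef WW); rewrite -gramE => x x_neq0.
have -> : x^T *m (X *m X^T) *m x = (X^T *m x)^T *m (X^T *m x).
  by rewrite trmx_mul trmxK !mulmxA.
rewrite -norm2_sqr_dot norm2_gt0 //; apply: contra x_neq0 => /eqP Xx0.
rewrite -trmx_eq0 -(mulmx_free_eq0 _ X_free); apply/eqP/trmx_inj.
by rewrite trmx_mul trmxK Xx0 trmx0.
Qed.

Lemma whitening_tight : (whitening *m X) *m (whitening *m X)^T = n%:R%:M.
Proof.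
have WtW : W^T *m W = 1%:M by exact: mulmx1C.
have PE : whitening = diag_mx (\row_i Num.sqrt (n%:R / g i)) *m W^T.
  by apply/matrixP => i j; rewrite mul_diag_mx !mxE.
rewrite trmx_mul mulmxA -[whitening *m X *m X^T]mulmxA gramE PE.
rewrite trmx_mul trmxK tr_diag_mx /spectral_mx !mulmxA.
rewrite -[_ *m W^T *m W]mulmxA WtW mulmx1 -[_ *m W^T *m W]mulmxA WtW mulmx1.
rewrite !mulmx_diag; apply/matrixP => i j; rewrite !mxE.
case: eqP => [->|_]; rewrite ?mulr0n // !mulr1n mulrAC -expr2 sqr_sqrtr.
  by rewrite divfK // gt_eqF // gram_eigenvalue_gt0.
by rewrite divr_ge0 ?ler0n // ltW // gram_eigenvalue_gt0.
Qed.

Lemma whitening_unit : whitening \in unitmx.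
Proof.
have := whitening_tight; rewrite -mulmxA => /(congr1 (fun A => n%:R^-1 *: A)).
rewrite scale_scalar_mx mulVf ?pnatr_eq0 -?lt0n // scalemxAr => /mulmx1_unit[].
by [].
Qed.

(** Every z is (whitening)^T x for some x, and for V = whitening *m X the vector
    V^T x = X^T z then has squared norm x^T (V V^T) x = n |x|^2. *)
Lemma whitening_lower_bound (S : {set 'I_n}) (c : R) :
  (forall x, c * norm2 x ^+ 2 <= \sum_(j in S) ((whitening *m X)^T *m x) j 0 ^+ 2) ->
  forall z, c / n%:R * norm2 (X^T *m z) ^+ 2 <= norm2 ((colset X S)^T *m z) ^+ 2.
Proof.
move=> bound z; have n0 : n%:R != 0 :> R by rewrite pnatr_eq0 -lt0n.
pose x := invmx whitening^T *m z.
have VxE : (whitening *m X)^T *m x = X^T *m z.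
  by rewrite trmx_mul /x -mulmxA mulKVmx // unitmx_tr whitening_unit.
have -> : norm2 (X^T *m z) ^+ 2 = n%:R * norm2 x ^+ 2.
  rewrite -VxE !norm2_sqr_dot [in LHS]trmx_mul trmxK -mulmxA (mulmxA (whitening *m X)).
  by rewrite whitening_tight mul_scalar_mx -scalemxAr mxE.
rewrite mulrA divfK //; apply: le_trans (bound x) _; rewrite VxE.
rewrite norm2_sqr big_enum_val /= le_eqVlt; apply/orP; left; apply/eqP.
apply: eq_bigr => i _; congr (_ ^+ 2).
by rewrite /colset !mxE; apply: eq_bigr => l _; rewrite !mxE.
Qed.

End Whitening.

Section Guarantee.
Variables (R : realType) (m n k : nat) (X : 'M[R]_(m, n)) (W : 'M[R]_m) (g : 'I_m -> R).
Hypotheses (m_gt0 : (0 < m)%N) (le_mk : (m <= k)%N) (n_gt0 : (0 < n)%N).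
Hypotheses (X_free : row_free X).
Hypotheses (WW : W *m W^T = 1%:M) (gramE : X *m X^T = spectral_mx W g).
Variables (S : {set 'I_n}) (U : 'M[R]_m) (d : 'I_m -> R).
Hypothesis UU : U *m U^T = 1%:M.
Hypothesis SE : outer_sum (whitening n W g *m X) S = spectral_mx U d.
Hypothesis final :
  barrier (outer_sum (whitening n W g *m X) S) (level R m k k) (height R m k).

Let alpha : R := rpar R m k ^+ 2 / m%:R / n%:R.

Let alpha_gt0 : 0 < alpha.
Proof. by rewrite !divr_gt0 ?exprn_gt0 ?rpar_gt0 ?ltr0n. Qed.

(** Every eigenvalue exceeds the last level by at least the height. *)
Lemma selection_dominates z :
  alpha * norm2 (X^T *m z) ^+ 2 <= norm2 ((colset X S)^T *m z) ^+ 2.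
Proof.
apply: (whitening_lower_bound n_gt0 X_free WW gramE) => x.
have H0 : 0 < height R m k :=
  lt_trans (shift_gt0 R m_gt0 le_mk) (lt_shift_height R m_gt0 le_mk).
move: final; rewrite SE => /(spectral_barrier UU m_gt0)[lb potential].
have gap := potential_gap H0 lb potential.
rewrite -outer_sum_form SE spectral_mx_form -level_final //.
have -> : norm2 x ^+ 2 = norm2 (U^T *m x) ^+ 2.
  by rewrite !norm2_sqr_dot trmx_mul trmxK -mulmxA (mulmxA U) UU mul1mx.
rewrite norm2_sqr mulr_sumr; apply: ler_sum => i _.
by rewrite ler_wpM2r ?sqr_ge0.
Qed.

Lemma selection_row_free : row_free (colset X S).
Proof. exact: dominated_row_free alpha_gt0 X_free selection_dominates. Qed.

Lemma selection_sharp xi :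
  mxnorm xi (mpinv (colset X S)) ^+ 2 <= sharp_factor R m n k * mxnorm xi (mpinv X) ^+ 2.
Proof.
have -> : sharp_factor R m n k = alpha^-1.
  rewrite sharp_factorE // /alpha; field.
  by rewrite !pnatr_eq0 -!lt0n m_gt0 n_gt0 /= gt_eqF ?rpar_gt0.
exact: dominated_mxnorm_mpinv alpha_gt0 X_free selection_dominates xi.
Qed.
End Guarantee.

(** * The effect of a program on memory *)

Section Semantics.
Variables (R : realType) (sub : subroutines R) (m n k : nat) (X : 'M[R]_(m, n)).

Definition memory := (imem * rmem R)%type.

Local Notation ieval := (ieval m n k).
Local Notation reval := (reval k X).
Local Notation beval := (beval k X).

(** The running time never influences the memory, so it is left out here. *)
Fixpoint mexec (c : cmd) (s : memory) : memory :=
  match c with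
  | Skip => s
  | Seq c1 c2 => mexec c2 (mexec c1 s)
  | SetN a i e => (iput s.1 a (ieval s.1 i) (ieval s.1 e), s.2)
  | SetR a i j e => (s.1, rput s.2 a (ieval s.1 i) (ieval s.1 j) (reval s.1 s.2 e))
  | If b c1 c2 => mexec (if beval s.1 s.2 b then c1 else c2) s
  | For x b c1 =>
      let s' := iteri (ieval s.1 b) (fun i s' => mexec c1 (iput s'.1 x 0 i, s'.2)) s in
      (iput s'.1 x 0 (s.1 x 0), s'.2)
  | MulXT => (s.1, mulXT_mem X s.2)
  | Evd a u l d => (s.1, evd_mem sub s.2 a u l (ieval s.1 d))
  | Bisect x e lo hi => (s.1, search_mem k X (@bisect R sub) s.1 s.2 x e lo hi)
  | Golden x e lo hi => (s.1, search_mem k X (@golden R sub) s.1 s.2 x e lo hi)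
  end%N.

Definition memory_of (st : config R) : memory := (ints st, reals st).

Lemma exec_memory TX c st :
  memory_of (exec sub k X TX c st) = mexec c (memory_of st).
Proof.
elim: c st => //=.
- by move=> c1 IH1 c2 IH2 st; rewrite IH2 IH1.
- by move=> b c1 IH1 c2 IH2 st; case: ifP => _; rewrite (IH1, IH2).
- move=> x b c1 IH st; rewrite {1}/memory_of /=.
  set st1 := iteri _ _ _; set s1 := iteri _ _ _.
  have E : memory_of st1 = s1.
    rewrite /st1 /s1; elim: (ieval _ b) => //= i {}IHi.
    by rewrite IH /memory_of /= -IHi.
  by rewrite -E.
Qed.

Lemma selected_mexec TX c (j : 'I_n) :
  (j \in selected sub k X TX c) =
  [exists i : 'I_k, (mexec c (fun _ _ => 0%N, fun _ _ _ => 0)).1 out i == j].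
Proof. by rewrite inE /run -(exec_memory TX c (init R)). Qed.

Lemma iput_iput N x i v w : iput (iput N x i v) x i w = iput N x i w.
Proof. by apply/funext => a; apply/funext => j; rewrite /iput; case: (_ && _). Qed.

Lemma iput_id N x i : iput N x i (N x i) = N.
Proof.
by apply/funext => a; apply/funext => j; rewrite /iput; case: ifP => // /andP[/eqP-> /eqP->].
Qed.

Fixpoint assigns_no_int (c : cmd) : bool :=
  match c with
  | Seq c1 c2 | If _ c1 c2 => assigns_no_int c1 && assigns_no_int c2
  | SetN _ _ _ => false
  | For _ _ c1 => assigns_no_int c1
  | _ => true
  end.

Lemma mexec_ints c s : assigns_no_int c -> (mexec c s).1 = s.1.
Proof.
elim: c s => //=.
- by move=> c1 IH1 c2 IH2 s /andP[p1 p2]; rewrite IH2 // IH1.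
- by move=> b c1 IH1 c2 IH2 s /andP[p1 p2]; case: ifP => _; [exact: IH1|exact: IH2].
- move=> x b c1 IH s p; elim: (ieval _ b) => [|i IHi] /=; first exact: iput_id.
  by rewrite IH //= iput_iput IHi.
Qed.

(** When the body assigns no integer, the loop counter is the only integer that
    the iterations see changing. *)
Lemma mexec_for x b c N A : assigns_no_int c ->
  mexec (For x b c) (N, A) =
  (N, iteri (ieval N b) (fun i A' => (mexec c (iput N x 0 i, A')).2) A).
Proof.
move=> p /=; set s := iteri _ _ _; set A1 := iteri _ _ _.
suff [v ->] : exists v, s = (iput N x 0 v, A1) by rewrite /= iput_iput iput_id.
rewrite /s /A1; elim: (ieval N b) => [|i [v IHi]] /=.
  by exists (N x 0%N); rewrite iput_id.
exists i; rewrite IHi /= iput_iput.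
by rewrite [LHS]surjective_pairing mexec_ints.
Qed.

Definition fill_row_mem (A : rmem R) a r b (f : nat -> R) : rmem R :=
  fun a' i j => if [&& a' == a, i == r & (j < b)%N] then f j else A a' i j.

Definition fill_row a r x b e := For x b (SetR a r (IVar x) e).

(** The entry that iteration i assigns may depend on its previous value, but
    on no other entry of the array being filled. *)
Lemma mexec_fill_row a r x b e N A r' (f : nat -> R) :
  (forall i, (i < ieval N b)%N -> ieval (iput N x 0 i) r = r') ->
  (forall i A', (i < ieval N b)%N ->
     (forall a' i' j', (a' != a) || (i' != r') || (j' == i) -> A' a' i' j' = A a' i' j') ->
     reval (iput N x 0 i) A' e = f i) ->
  mexec (fill_row a r x b e) (N, A) = (N, fill_row_mem A a r' (ieval N b) f).
Proof.
move=> rE fE; rewrite mexec_for //; congr (_, _).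
elim: (ieval N b) {-2}(ieval N b) (leqnn (ieval N b)) fE rE => [|l IH] l' le_l fE rE.
  move: le_l; rewrite leqn0 => /eqP-> /=; apply/funext => a'; apply/funext => i'.
  by apply/funext => j'; rewrite /fill_row_mem ltn0 !andbF.
move: le_l; rewrite leq_eqVlt => /orP[/eqP l'E|]; last by rewrite ltnS => ?; exact: IH.
rewrite l'E /= (IH l) // => [|i A' il|i il]; last 2 first.
- by apply: fE; rewrite l'E ltnS ltnW.
- by apply: rE; rewrite l'E ltnS ltnW.
have lE : iput N x 0 l x 0%N = l by rewrite /iput !eqxx.
rewrite lE rE ?l'E // (fE l); last 2 first.
- by rewrite l'E.
- move=> a' i' j'; rewrite /fill_row_mem; case: ifP => // /and3P[/eqP-> /eqP-> jl].
  by rewrite !eqxx /= (ltn_eqF jl).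
apply/funext => a'; apply/funext => i'; apply/funext => j'.
rewrite /rput /fill_row_mem; case: eqP => //= _; case: eqP => //= _.
by rewrite ltnS [in RHS]leq_eqVlt; case: eqP => //= ->.
Qed.

Definition fill_mem (A : rmem R) a b1 b2 (f : nat -> nat -> R) : rmem R :=
  fun a' i j => if [&& a' == a, (i < b1)%N & (j < b2)%N] then f i j else A a' i j.

Definition fill a x1 b1 x2 b2 e := For x1 b1 (fill_row a (IVar x1) x2 b2 e).

Lemma mexec_fill a x1 b1 x2 b2 e N A (f : nat -> nat -> R) c2 :
  x1 != x2 ->
  (forall i, ieval (iput N x1 0 i) b2 = c2) ->
  (forall i j A', (i < ieval N b1)%N -> (j < c2)%N ->
     (forall a' i' j', (a' != a) || ((i' == i) && (j' == j)) -> A' a' i' j' = A a' i' j') ->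
     reval (iput (iput N x1 0 i) x2 0 j) A' e = f i j) ->
  mexec (fill a x1 b1 x2 b2 e) (N, A) = (N, fill_mem A a (ieval N b1) c2 f).
Proof.
move=> x12 b2E fE; rewrite mexec_for //; congr (_, _).
elim: (ieval N b1) {-2}(ieval N b1) (leqnn (ieval N b1)) fE => [|l IH] l' le_l fE.
  move: le_l; rewrite leqn0 => /eqP-> /=; apply/funext => a'; apply/funext => i'.
  by apply/funext => j'; rewrite /fill_mem ltn0 !andbF.
move: le_l; rewrite leq_eqVlt => /orP[/eqP l'E|]; last by rewrite ltnS => ?; exact: IH.
rewrite l'E iteriS (IH l) // => [|i j A' il]; last by apply: fE; rewrite l'E ltnS ltnW.
rewrite (@mexec_fill_row _ _ _ _ _ _ _ l (f l)) => [|i _|i A' ic AE].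
- rewrite b2E; apply/funext => a'; apply/funext => i'; apply/funext => j'.
  rewrite /fill_row_mem /fill_mem /=; case: eqP => //= _.
  rewrite ltnS [in RHS]leq_eqVlt; case: (i' =P l) => [->|_] //=.
  by rewrite ltnn /=.
- by rewrite /= /iput (negbTE x12) !eqxx.
- apply: fE; rewrite ?l'E // -?(b2E l) // => a' i' j' h.
  rewrite AE; last by move: h; case: eqP => //= _; case: eqP => //=.
  rewrite /fill_mem; case: ifP => // /and3P[/eqP a'E i'l _].
  by move: h; rewrite a'E eqxx /= => /andP[/eqP i'E _]; rewrite i'E ltnn in i'l.
Qed.

Lemma entryE (i : 'I_m) (j : 'I_n) : entry X i j = X i j.
Proof. by rewrite /entry !valK. Qed.

(** The spelled-out product overwrites only the row that the primitive does, and
    restores the two counters that it uses. *)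
Lemma mexec_dense c s : mexec (dense c) s = mexec c s.
Proof.
elim: c s => //=.
- by move=> c1 IH1 c2 IH2 s; rewrite IH1 IH2.
- by move=> b c1 IH1 c2 IH2 s; case: ifP.
- move=> x b c1 IH s.
  by have -> : (fun i s' => mexec (dense c1) (iput s'.1 x 0 i, s'.2)) =
    (fun i s' => mexec c1 (iput s'.1 x 0 i, s'.2)) by apply/funext => i; apply/funext.
- move=> [N A].
  apply: (@mexec_fill_row rout (INum 0) 0 IDimN
    (RSum 1 IDimM (RMul (RX (IVar 1) (IVar 0)) (RArr rin (INum 0) (IVar 1)))) N A 0%N
    (fun j => \sum_(l < m) entry X l j * A rin 0%N l)) => // j A' _ AE.
  by apply: eq_bigr => l _; rewrite /= AE.
Qed.
End Semantics.

(** * Running times that depend on the dimensions only *)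

Section StaticCost.
Variables (m n k TX : nat).

Definition static_index (e : iexp) : bool :=
  match e with INum _ | IDimM | IDimN | IDimK => true | _ => false end.

Definition static_value (e : iexp) : nat := ieval m n k (fun _ _ => 0%N) e.

Fixpoint static_rexp (e : rexp) : bool :=
  match e with
  | RAdd e1 e2 | RSub e1 e2 | RMul e1 e2 | RDiv e1 e2 => static_rexp e1 && static_rexp e2
  | RSqrt e1 => static_rexp e1
  | RSum _ b e1 => static_index b && static_rexp e1
  | _ => true
  end.

Fixpoint rexp_cost (e : rexp) : nat :=
  match e with
  | RNat i => icost i
  | RX i j | RArr _ i j => icost i + icost j
  | RAdd e1 e2 | RSub e1 e2 | RMul e1 e2 | RDiv e1 e2 => (rexp_cost e1 + rexp_cost e2).+1
  | RSqrt e1 => (rexp_cost e1).+1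
  | RSum _ b e1 => icost b + static_value b * (rexp_cost e1).+1
  end%N.

Fixpoint static_bexp (b : bexp) : bool :=
  match b with
  | BLeR e1 e2 | BLtR e1 e2 => static_rexp e1 && static_rexp e2
  | BLeN _ _ | BEqN _ _ => true
  | BNot b1 => static_bexp b1
  | BAnd b1 b2 => static_bexp b1 && static_bexp b2
  end.

Fixpoint bexp_cost (b : bexp) : nat :=
  match b with
  | BLeR e1 e2 | BLtR e1 e2 => (rexp_cost e1 + rexp_cost e2).+1
  | BLeN e1 e2 | BEqN e1 e2 => (icost e1 + icost e2).+1
  | BNot b1 => (bexp_cost b1).+1
  | BAnd b1 b2 => (bexp_cost b1 + bexp_cost b2).+1
  end%N.

Fixpoint static_cmd (c : cmd) : bool :=
  match c with
  | Skip | SetN _ _ _ | MulXT => true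
  | Seq c1 c2 => static_cmd c1 && static_cmd c2
  | SetR _ _ _ e => static_rexp e
  | If b c1 c2 => [&& static_bexp b, static_cmd c1 & static_cmd c2]
  | For _ b c1 => static_index b && static_cmd c1
  | Evd _ _ _ d => static_index d
  | Bisect _ e lo hi | Golden _ e lo hi => [&& static_rexp e, static_rexp lo & static_rexp hi]
  end.

Fixpoint cmd_cost (c : cmd) : nat :=
  match c with
  | Skip => 0
  | Seq c1 c2 => cmd_cost c1 + cmd_cost c2
  | SetN _ i e => (icost i + icost e).+1
  | SetR _ i j e => (icost i + icost j + rexp_cost e).+1
  | If b c1 c2 => bexp_cost b + (cmd_cost c1 + cmd_cost c2)
  | For _ b c1 => (icost b).+1 + static_value b * (cmd_cost c1).+1
  | MulXT => TX
  | Evd _ _ _ d => (icost d + static_value d ^ 3).+1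
  | Bisect _ e lo hi | Golden _ e lo hi => (rexp_cost lo + rexp_cost hi + rexp_cost e).+1
  end%N.

Lemma static_valueE N e : static_index e -> ieval m n k N e = static_value e.
Proof. by case: e. Qed.

Lemma rcostE N e : static_rexp e -> rcost m n k N e = rexp_cost e.
Proof.
elim: e N => //=; try by move=> e1 IH1 e2 IH2 N /andP[p1 p2]; rewrite IH1 // IH2.
- by move=> e IH N p; rewrite IH.
- move=> x b e IH N /andP[pb pe]; rewrite (static_valueE _ pb); congr (_ + _)%N.
  by under eq_bigr do rewrite IH //; rewrite sum_nat_const card_ord.
Qed.

Lemma bcostE N b : static_bexp b -> bcost m n k N b = bexp_cost b.
Proof.
elim: b => //=; try by move=> e1 e2 /andP[p1 p2]; rewrite !rcostE.
- by move=> b IH p; rewrite IH.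
- by move=> b1 IH1 b2 IH2 /andP[p1 p2]; rewrite IH1 // IH2.
Qed.

(** When loop and summation bounds are dimensions of the input, the running
    time is bounded by an expression that does not depend on the memory. *)
Lemma exec_cost (R : realType) (sub : subroutines R) (X : 'M[R]_(m, n)) c st :
  static_cmd c -> (ops (exec sub k X TX c st) <= ops st + cmd_cost c)%N.
Proof.
elim: c st => //=.
- by move=> st _; rewrite addn0.
- move=> c1 IH1 c2 IH2 st /andP[p1 p2]; apply: leq_trans (IH2 _ p2) _.
  by rewrite addnA leq_add2r IH1.
- by move=> a i j e st p; rewrite rcostE.
- move=> b c1 IH1 c2 IH2 st /and3P[pb p1 p2].
  have le3 d1 d2 : (d1 <= d2)%N ->
      (ops st + bcost m n k (ints st) b + d1 <= ops st + (bexp_cost b + d2))%N.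
    by move=> le12; rewrite bcostE // addnA leq_add2l.
  by case: ifP => _; [apply: leq_trans (IH1 _ p1) _|apply: leq_trans (IH2 _ p2) _];
     apply: le3; rewrite ?leq_addr ?leq_addl.
- move=> x b c IH st /andP[pb p]; rewrite (static_valueE _ pb).
  elim: (static_value b) => [|i IHi] /=; first by rewrite mul0n addn0.
  apply: leq_trans (IH _ p) _; rewrite /= mulSn addn1.
  rewrite addSn -addnS (addnC (cmd_cost c).+1) 2!addnA leq_add2r -addnA.
  exact: IHi.
- by move=> a u l d st p; rewrite (static_valueE _ p).
- by move=> x e lo hi st /and3P[pe pl ph]; rewrite !rcostE.
- by move=> x e lo hi st /and3P[pe pl ph]; rewrite !rcostE.
Qed.
End StaticCost.

(** * The program *)

(* Real arrays 0 and 1 are rin and rout, and integer array 0 is out. *)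
Notation gram_arr := 2%N (only parsing).
Notation evec_arr := 3%N (only parsing).
Notation eval_arr := 4%N (only parsing).
Notation white_arr := 5%N (only parsing).
Notation accum_arr := 6%N (only parsing).
Notation score_arr := 7%N (only parsing).
Notation weight_arr := 8%N (only parsing).

Notation used_arr := 2%N (only parsing).
Notation best_var := 3%N (only parsing).
Notation round_var := 4%N (only parsing).
Notation row_var := 5%N (only parsing).
Notation col_var := 6%N (only parsing).
Notation sum_var := 7%N (only parsing).

Definition zero_idx := INum 0.
Definition one_exp := RNat (INum 1).
Definition dim_exp := RNat IDimM.

Definition gram_exp :=
  RSum sum_var IDimN
    (RMul (RX (IVar row_var) (IVar sum_var)) (RX (IVar col_var) (IVar sum_var))).

Definition whitening_exp :=
  RMul (RSqrt (RDiv (RNat IDimN) (RArr eval_arr zero_idx (IVar row_var))))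
       (RArr evec_arr (IVar col_var) (IVar row_var)).

Definition qpar_exp :=
  RSqrt (RAdd (RMul (RSub (RNat IDimK) one_exp) dim_exp) one_exp).
Definition rpar_exp := RAdd (RSub qpar_exp dim_exp) one_exp.
Definition shift_exp := RDiv rpar_exp qpar_exp.
Definition height_exp :=
  RDiv (RMul rpar_exp (RAdd qpar_exp one_exp)) (RMul dim_exp qpar_exp).
Definition level_exp :=
  RSub (RMul (RNat (IAdd (IVar round_var) (INum 1))) shift_exp)
       (RMul dim_exp height_exp).

Definition gap_inv_exp x :=
  RDiv one_exp (RSub (RArr eval_arr zero_idx (IVar x)) level_exp).
Definition excess_exp :=
  RSub (RSum sum_var IDimM (gap_inv_exp sum_var)) (RDiv one_exp height_exp).
Definition weight_exp :=
  RSub (RMul (gap_inv_exp row_var) (gap_inv_exp row_var))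
       (RMul excess_exp (gap_inv_exp row_var)).

Definition eigenrow_exp :=
  RSum sum_var IDimM
    (RMul (RArr evec_arr (IVar sum_var) (IVar row_var))
          (RArr white_arr (IVar sum_var) (IVar col_var))).

Definition score_exp :=
  RAdd (RArr score_arr zero_idx (IVar col_var))
       (RMul (RArr weight_arr zero_idx (IVar row_var))
             (RMul (RArr rout zero_idx (IVar col_var)) (RArr rout zero_idx (IVar col_var)))).

Definition white_column_exp x :=
  RSum sum_var IDimM
    (RMul (RArr white_arr (IVar x) (IVar sum_var)) (RX (IVar sum_var) (IVar best_var))).

Definition accum_exp :=
  RAdd (RArr accum_arr (IVar row_var) (IVar col_var))
       (RMul (white_column_exp row_var) (white_column_exp col_var)).

Definition set_best := SetN best_var zero_idx (IVar col_var).

Definition add_row_score :=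
  Seq (fill_row rin zero_idx col_var IDimM eigenrow_exp)
 (Seq MulXT (fill_row score_arr zero_idx col_var IDimN score_exp)).

Definition compare_best :=
  If (BEqN (IArr used_arr (IVar col_var)) (INum 0))
     (If (BEqN (IVar best_var) IDimN) set_best
         (If (BLtR (RArr score_arr zero_idx (IVar best_var))
                   (RArr score_arr zero_idx (IVar col_var))) set_best Skip))
     Skip.

Definition spectral_phase :=
  Seq (Evd accum_arr evec_arr eval_arr IDimM)
      (fill_row weight_arr zero_idx row_var IDimM weight_exp).

(** The product X^T p with the i-th row p of U^T P consists of the i-th
    coordinates of all whitened columns in the eigenbasis U of A, so m
    products yield all scores. *)
Definition score_phase :=
  Seq (fill_row score_arr zero_idx col_var IDimN (RNat (INum 0)))
      (For row_var IDimM add_row_score).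

(** The number n, which indexes no column, stands for the absence of a choice. *)
Definition choice_phase :=
  Seq (SetN best_var zero_idx IDimN) (For col_var IDimN compare_best).

Definition update_phase :=
  Seq (SetN out (IVar round_var) (IVar best_var))
 (Seq (SetN used_arr (IVar best_var) (INum 1))
      (fill accum_arr row_var IDimM col_var IDimM accum_exp)).

Definition selection_round :=
  Seq spectral_phase (Seq score_phase (Seq choice_phase update_phase)).

Definition whitening_phase :=
  Seq (fill gram_arr row_var IDimM col_var IDimM gram_exp)
 (Seq (Evd gram_arr evec_arr eval_arr IDimM)
      (fill white_arr row_var IDimM col_var IDimM whitening_exp)).

Definition barrier_selection :=
  Seq whitening_phase (For round_var IDimK selection_round).

(** * Correctness of the program *)

Lemma iteri_ind (T : Type) (P : nat -> T -> Prop) (f : nat -> T -> T) s l :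
  P 0%N s -> (forall i s', (i < l)%N -> P i s' -> P i.+1 (f i s')) -> P l (iteri l f s).
Proof.
move=> P0 PS; elim: l PS => //= l IH PS; apply: (PS) => //.
by apply: IH => i s' il; apply: PS; rewrite ltnS ltnW.
Qed.

Section Correctness.
Variables (R : realType) (sub : subroutines R) (m n k : nat) (X : 'M[R]_(m, n)).
Local Notation mexec := (mexec sub k X).

Lemma mexec_seq c1 c2 s : mexec (Seq c1 c2) s = mexec c2 (mexec c1 s).
Proof. by []. Qed.

Lemma mexec_evd a u l d N A :
  mexec (Evd a u l d) (N, A) = (N, evd_mem sub A a u l (ieval m n k N d)).
Proof. by []. Qed.

Lemma mexec_if b c1 c2 s :
  mexec (If b c1 c2) s = mexec (if beval k X s.1 s.2 b then c1 else c2) s.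
Proof. by []. Qed.

Definition loaded (A : rmem R) a (M : 'M[R]_m) := forall i j : 'I_m, A a i j = M i j.

Lemma evd_mem_row (A : rmem R) a u l (i : 'I_m) : evd_mem sub A a u l m l 0%N i =
  (evd sub (\matrix_(i < m, j < m) A a i j)).2 0 i.
Proof.
by rewrite /evd_mem; case: (evd sub _) => U lam; rewrite !eqxx ltn_ord /= valK.
Qed.

Lemma evd_mem_vec (A : rmem R) a u l (i j : 'I_m) : u != l -> evd_mem sub A a u l m u i j =
  (evd sub (\matrix_(i < m, j < m) A a i j)).1 i j.
Proof.
move=> ul; rewrite /evd_mem; case: (evd sub _) => U lam.
by rewrite (negbTE ul) eqxx !ltn_ord /= !valK.
Qed.

Lemma evd_mem_other (A : rmem R) a u l a' i j : a' != u -> a' != l ->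
  evd_mem sub A a u l m a' i j = A a' i j.
Proof.
move=> au al; rewrite /evd_mem; case: (evd sub _) => U lam.
by rewrite (negbTE au) (negbTE al).
Qed.

Lemma fill_row_mem_in (A : rmem R) a r b f (j : 'I_b) : fill_row_mem A a r b f a r j = f j.
Proof. by rewrite /fill_row_mem !eqxx ltn_ord. Qed.

Lemma fill_row_mem_other (A : rmem R) a r b f a' i j :
  a' != a -> fill_row_mem A a r b f a' i j = A a' i j.
Proof. by move=> aa; rewrite /fill_row_mem (negbTE aa). Qed.

Lemma fill_mem_in (A : rmem R) a b1 b2 f (i : 'I_b1) (j : 'I_b2) :
  fill_mem A a b1 b2 f a i j = f i j.
Proof. by rewrite /fill_mem eqxx !ltn_ord. Qed.

Lemma fill_mem_other (A : rmem R) a b1 b2 f a' i j :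
  a' != a -> fill_mem A a b1 b2 f a' i j = A a' i j.
Proof. by move=> aa; rewrite /fill_mem (negbTE aa). Qed.

Lemma level_expE (N : imem) (A : rmem R) t : N round_var 0%N = t ->
  reval k X N A level_exp = level R m k t.+1.
Proof. by move=> /= ->; rewrite addn1. Qed.

Lemma reval_sum N (A : rmem R) x b e :
  reval k X N A (RSum x b e) =
  \sum_(i < ieval m n k N b) reval k X (iput N x 0%N i) A e.
Proof. by []. Qed.

Lemma gap_inv_expE (N : imem) (A : rmem R) t x : N round_var 0%N = t ->
  reval k X N A (gap_inv_exp x) = (A eval_arr 0%N (N x 0%N) - level R m k t.+1)^-1.
Proof. by move=> /(level_expE A) E; rewrite /gap_inv_exp /= -E mul1r. Qed.

Lemma weight_expE (N : imem) (A : rmem R) t (lam : 'rV[R]_m) (i : 'I_m) :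
  N round_var 0%N = t -> N row_var 0%N = i ->
  (forall i : 'I_m, A eval_arr 0%N i = lam 0 i) ->
  reval k X N A weight_exp = weight k (fun i => lam 0 i) (level R m k t.+1) i.
Proof.
move=> Nt Ni AE; rewrite /weight_exp.
set g := gap_inv_exp row_var.
have -> : reval k X N A (RSub (RMul g g) (RMul excess_exp g)) =
  reval k X N A g * reval k X N A g - reval k X N A excess_exp * reval k X N A g by [].
rewrite (gap_inv_expE _ _ Nt) Ni AE /weight expr2; congr (_ - _ * _).
rewrite /excess_exp /potential_excess.
transitivity (reval k X N A (RSum sum_var IDimM (gap_inv_exp sum_var)) - 1 / height R m k).
  by [].
rewrite div1r reval_sum; congr (_ - _); apply: eq_bigr => l _.
by rewrite (gap_inv_expE _ _ (t := t)) // -AE.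
Qed.

Lemma spectral_phase_spec (N : imem) (A : rmem R) t :
  N round_var 0%N = t ->
  let ev := evd sub (\matrix_(i < m, j < m) A accum_arr i j) in
  exists A', [/\ mexec spectral_phase (N, A) = (N, A'),
    loaded A' evec_arr ev.1,
    forall i : 'I_m, A' weight_arr 0%N i =
      weight k (fun i => ev.2 0 i) (level R m k t.+1) i
    & forall a i j, a \notin [:: evec_arr; eval_arr; weight_arr] -> A' a i j = A a i j].
Proof.
move=> Nt ev; set A1 := evd_mem sub A accum_arr evec_arr eval_arr m.
pose w i := reval k X (iput N row_var 0 i) A1 weight_exp.
have A1E (i : 'I_m) : A1 eval_arr 0%N i = ev.2 0 i by exact: evd_mem_row.
exists (fill_row_mem A1 weight_arr 0 m w); split.
- rewrite /spectral_phase mexec_seq mexec_evd.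
  apply: mexec_fill_row => // i A' im AE.
  rewrite /w (weight_expE (t := t) (lam := ev.2) (i := Ordinal im)) //; last first.
    by move=> i'; rewrite AE.
  by rewrite (weight_expE (t := t) (lam := ev.2) (i := Ordinal im)).
- by move=> i j; rewrite fill_row_mem_other // /A1 evd_mem_vec.
- by move=> i; rewrite fill_row_mem_in /w (weight_expE (t := t) (lam := ev.2) (i := i)).
- move=> a i j; rewrite !inE !negb_or => /and3P[a3 a4 a8].
  by rewrite fill_row_mem_other // /A1 evd_mem_other.
Qed.
Lemma mexec_mulXT N A : mexec MulXT (N, A) = (N, mulXT_mem X A).
Proof. by []. Qed.

Lemma add_row_score_spec (N : imem) (A : rmem R) (U P : 'M[R]_m) (i : 'I_m) :
  N row_var 0%N = i -> loaded A evec_arr U -> loaded A white_arr P ->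
  exists A', [/\ mexec add_row_score (N, A) = (N, A'),
    forall j : 'I_n, A' score_arr 0%N j =
      A score_arr 0%N j + A weight_arr 0%N i * (U^T *m (P *m X)) i j ^+ 2
    & forall a i' j', a \notin [:: rin; rout; score_arr] -> A' a i' j' = A a i' j'].
Proof.
move=> Ni AU AP.
pose row j := reval k X (iput N col_var 0 j) A eigenrow_exp.
set A1 := mulXT_mem X (fill_row_mem A rin 0 m row).
pose total j := A score_arr 0%N j + A weight_arr 0%N i * (A1 rout 0%N j * A1 rout 0%N j).
have rowE (l : 'I_m) : row l = (U^T *m P) i l.
  rewrite /row /eigenrow_exp reval_sum mxE; apply: eq_bigr => l' _.
  by rewrite mxE -AU -AP /= /iput /= Ni.
have A1E (j : 'I_n) : A1 rout 0%N j = (U^T *m (P *m X)) i j.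
  rewrite /A1 /mulXT_mem !eqxx ltn_ord /= mulmxA mxE; apply: eq_bigr => l _.
  by rewrite entryE fill_row_mem_in rowE mulrC.
exists (fill_row_mem A1 score_arr 0 n total); split.
- rewrite /add_row_score 2!mexec_seq.
  rewrite (@mexec_fill_row _ _ _ _ _ _ rin _ _ _ _ _ _ 0%N row) //; last first.
    move=> j A' _ AE; rewrite /row /eigenrow_exp !reval_sum; apply: eq_bigr => l _.
    by rewrite /= !AE.
  rewrite mexec_mulXT; apply: mexec_fill_row => // j A' _ AE.
  by rewrite /= !AE ?eqxx ?orbT //= /iput /= Ni.
- by move=> j; rewrite fill_row_mem_in /total A1E expr2.
- move=> a i' j'; rewrite !inE !negb_or => /and3P[a0 a1 a7].
  by rewrite fill_row_mem_other // /A1 /mulXT_mem (negbTE a1) /= fill_row_mem_other.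
Qed.

Lemma score_phase_spec (N : imem) (A : rmem R) (U P : 'M[R]_m) :
  loaded A evec_arr U -> loaded A white_arr P ->
  exists A', [/\ mexec score_phase (N, A) = (N, A'),
    forall j : 'I_n, A' score_arr 0%N j =
      \sum_(i < m) A weight_arr 0%N i * (U^T *m (P *m X)) i j ^+ 2
    & forall a i j, a \notin [:: rin; rout; score_arr] -> A' a i j = A a i j].
Proof.
move=> AU AP; set A0 := fill_row_mem A score_arr 0 n (fun=> 0).
pose step i A' := (mexec add_row_score (iput N row_var 0 i, A')).2.
exists (iteri m step A0).
pose Inv l (A' : rmem R) :=
  (forall j : 'I_n, A' score_arr 0%N j =
     \sum_(i < m | (i < l)%N) A weight_arr 0%N i * (U^T *m (P *m X)) i j ^+ 2) /\
  (forall a i j, a \notin [:: rin; rout; score_arr] -> A' a i j = A a i j).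
have [scoreE otherE] : Inv m (iteri m step A0).
  apply: iteri_ind => [|i A' im [A'score A'other]].
    split=> [j|a i j]; first by rewrite /A0 fill_row_mem_in big_pred0.
    rewrite !inE !negb_or => /and3P[_ _ a7].
    by rewrite /A0 fill_row_mem_other.
  have [| | |A2 [A2E A2score A2other]] :=
      @add_row_score_spec (iput N row_var 0 i) A' U P (Ordinal im).
  - by [].
  - by move=> i1 j1; rewrite A'other.
  - by move=> i1 j1; rewrite A'other.
  rewrite /step A2E /=; split=> [j|a i1 j1 aN]; last by rewrite A2other // A'other.
  rewrite A2score A'score [RHS](bigD1 (Ordinal im)) ?ltnS //= [RHS]addrC A'other //; congr (_ + _).
  by apply: eq_bigl => i1; rewrite ltnS andbC -val_eqE /= ltn_neqAle.
split=> // [|j]; last by rewrite scoreE; apply: eq_bigl => i; rewrite ltn_ord.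
rewrite /score_phase mexec_seq.
rewrite (@mexec_fill_row _ _ _ _ _ _ _ _ _ _ _ _ _ 0%N (fun=> 0)) //.
by rewrite mexec_for.
Qed.
Lemma iput_restore (N : imem) x y v : x != y ->
  iput (iput N y 0%N v) x 0%N (N x 0%N) = iput N y 0%N v.
Proof.
move=> xy; have -> : N x 0%N = iput N y 0%N v x 0%N by rewrite /iput (negbTE xy).
exact: iput_id.
Qed.

Definition flags (N : imem) (S : {set 'I_n}) := forall j : 'I_n, N used_arr j = (j \in S).

(** The value v of the choice variable after the first l columns. *)
Definition best_below (N : imem) (A : rmem R) (S : {set 'I_n}) l v :=
  (v = n /\ forall j : 'I_n, (j < l)%N -> j \in S) \/
  exists j0 : 'I_n, [/\ v = j0, j0 \notin S
    & forall j : 'I_n, (j < l)%N -> j \notin S -> A score_arr 0%N j <= A score_arr 0%N j0].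

Lemma compare_best_spec (N : imem) (A : rmem R) (S : {set 'I_n}) (i : 'I_n) v :
  flags N S -> best_below N A S i v ->
  exists2 v', best_below N A S i.+1 v' &
    mexec compare_best (iput (iput N best_var 0 v) col_var 0 i, A) =
    (iput (iput N best_var 0 v') col_var 0 i, A).
Proof.
move=> NS best.
have swap : iput (iput (iput N best_var 0 v) col_var 0 i) best_var 0 i =
            iput (iput N best_var 0 i) col_var 0 i.
  apply/funext => a; apply/funext => b; rewrite /iput.
  by case: (a =P best_var) => [->|_] //=; case: (b == 0%N).
have flagE : (N used_arr i == 0%N) = (i \notin S) by rewrite NS; case: (i \in S).
set s := (iput (iput N best_var 0 v) col_var 0 i, A).
have set_bestE : mexec set_best s = (iput (iput N best_var 0 i) col_var 0 i, A).
  by rewrite -swap.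
pose v' := if i \notin S then
  if v == n then nat_of_ord i
  else if A score_arr 0%N v < A score_arr 0%N i then nat_of_ord i else v else v.
have E : mexec compare_best s = (iput (iput N best_var 0 v') col_var 0 i, A).
  rewrite /compare_best mexec_if.
  have -> : beval k X s.1 s.2 (BEqN (IArr used_arr (IVar col_var)) (INum 0)) = (i \notin S).
    by rewrite -flagE.
  rewrite /v'; case: ifP => // _; rewrite mexec_if.
  have -> : beval k X s.1 s.2 (BEqN (IVar best_var) IDimN) = (v == n) by [].
  case: ifP => // _; rewrite mexec_if.
  have -> : beval k X s.1 s.2 (BLtR (RArr score_arr zero_idx (IVar best_var))
     (RArr score_arr zero_idx (IVar col_var))) = (A score_arr 0%N v < A score_arr 0%N i) by [].
  by case: ifP.
exists v' => //; rewrite /v' /best_below.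
have old (j : 'I_n) : (j < i.+1)%N -> j != i -> (j < i)%N.
  by rewrite ltnS [in X in X -> _]leq_eqVlt -val_eqE => /orP[->|].
case: ifP => [iS|/negbFE iS].
- case: best => [[vn below]|[j0 [vj0 j0S below]]].
    rewrite vn eqxx; right; exists i; split=> // j ji jS.
    have [->//|/(old _ ji)/below] := eqVneq j i.
    by rewrite (negbTE jS).
  rewrite vj0 ltn_eqF //; right; case: ltP => le_score.
    exists i; split=> // j ji jS; have [->//|/(old _ ji) jl] := eqVneq j i.
    by apply: le_trans (below j jl jS) (ltW le_score).
  by exists j0; split=> // j ji jS; have [->//|/(old _ ji)/below ->] := eqVneq j i.
- case: best => [[vn below]|[j0 [vj0 j0S below]]].
    left; split=> // j ji; have [->//|/(old _ ji)/below] := eqVneq j i.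
    by [].
  right; exists j0; split=> // j ji jS.
  have [jE|/(old _ ji)/below ->//] := eqVneq j i.
  by rewrite -jE (negbTE jS) in iS.
Qed.

Lemma choice_phase_spec (N : imem) (A : rmem R) (S : {set 'I_n}) :
  flags N S -> (#|S| < n)%N ->
  exists j0 : 'I_n, [/\ j0 \notin S,
    forall j, j \notin S -> A score_arr 0%N j <= A score_arr 0%N j0
    & mexec choice_phase (N, A) = (iput N best_var 0 j0, A)].
Proof.
move=> NS Sn; rewrite /choice_phase mexec_seq.
have -> : mexec (SetN best_var zero_idx IDimN) (N, A) = (iput N best_var 0 n, A) by [].
pose step i s' := mexec compare_best (iput s'.1 col_var 0 i, s'.2).
pose Inv l (s' : memory R) := exists v w,
  best_below N A S l v /\ s' = (iput (iput N best_var 0 v) col_var 0 w, A).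
have [v [w [best sE]]] : Inv n (iteri n step (iput N best_var 0 n, A)).
  apply: iteri_ind => [|i s' im [v [w [best ->]]]].
    exists n, (N col_var 0%N); split; first by left.
    by rewrite iput_restore.
  have [v' best' E] := @compare_best_spec N A S (Ordinal im) v NS best.
  by exists v', i; split=> //; rewrite /step /= iput_iput.
have stepE : mexec (For col_var IDimN compare_best) (iput N best_var 0 n, A) =
    (iput (iteri n step (iput N best_var 0 n, A)).1 col_var 0 (N col_var 0%N),
     (iteri n step (iput N best_var 0 n, A)).2) by [].
have doneE : mexec (For col_var IDimN compare_best) (iput N best_var 0 n, A) =
    (iput N best_var 0 v, A).
  by rewrite stepE sE /= iput_iput iput_restore.
case: best => [[_ all_used]|[j0 [vj0 j0S below]]].
  have : S = [set: 'I_n]%SET by apply/setP => j; rewrite inE all_used.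
  by move=> ST; rewrite ST cardsT card_ord ltnn in Sn.
by exists j0; split=> // [j jS|]; [exact: below|rewrite doneE vj0].
Qed.
Lemma white_column_expE (N : imem) (A : rmem R) (P : 'M[R]_m) x (i : 'I_m) (j : 'I_n) :
  x != sum_var -> loaded A white_arr P ->
  N x 0%N = i -> N best_var 0%N = j ->
  reval k X N A (white_column_exp x) = (P *m X) i j.
Proof.
move=> x_sum AP Nx Nbest; rewrite /white_column_exp reval_sum mxE.
apply: eq_bigr => l _ /=.
have -> : iput N sum_var 0 l x 0%N = i by rewrite /iput (negbTE x_sum).
have -> : iput N sum_var 0 l best_var 0%N = j by rewrite -Nbest.
by rewrite AP entryE.
Qed.

Lemma update_phase_spec (N : imem) (A : rmem R) (P : 'M[R]_m) (S : {set 'I_n}) t (j : 'I_n) :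
  N round_var 0%N = t -> N best_var 0%N = j -> j \notin S ->
  loaded A white_arr P -> loaded A accum_arr (outer_sum (P *m X) S) ->
  exists A', [/\ mexec update_phase (N, A) =
      (iput (iput N out t j) used_arr j 1%N, A'),
    loaded A' accum_arr (outer_sum (P *m X) (j |: S))
    & forall a i j, a != accum_arr -> A' a i j = A a i j].
Proof.
move=> Nt Nbest jS AP AS; set N' := iput (iput N out t j) used_arr j 1%N.
pose f i1 i2 := reval k X (iput (iput N' row_var 0 i1) col_var 0 i2) A accum_exp.
have fE (i1 i2 : 'I_m) (A' : rmem R) :
    loaded A' white_arr P -> A' accum_arr i1 i2 = A accum_arr i1 i2 ->
    reval k X (iput (iput N' row_var 0 i1) col_var 0 i2) A' accum_exp =
    outer_sum (P *m X) (j |: S) i1 i2.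
  move=> A'P A'S.
  transitivity (A' accum_arr i1 i2 +
    reval k X (iput (iput N' row_var 0 i1) col_var 0 i2) A' (white_column_exp row_var) *
    reval k X (iput (iput N' row_var 0 i1) col_var 0 i2) A' (white_column_exp col_var)).
    by [].
  rewrite (@white_column_expE _ _ P row_var i1 j) // (@white_column_expE _ _ P col_var i2 j) //.
  by rewrite outer_sum_setU1 // [RHS]mxE A'S AS; congr (_ + _); rewrite [RHS]mxE big_ord1 ![in RHS]mxE !mxE.
exists (fill_mem A accum_arr m m f); split=> [|i1 i2|a i1 i2 a6].
- have -> : mexec update_phase (N, A) =
    mexec (fill accum_arr row_var IDimM col_var IDimM accum_exp) (N', A).
    by rewrite /N' -Nt -Nbest.
  apply: mexec_fill => // i1 i2 A' i1m i2m AE.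
  rewrite /f (@fE (Ordinal i1m) (Ordinal i2m)) // ?(@fE (Ordinal i1m) (Ordinal i2m)) //.
    by move=> j1 j2; rewrite AE.
  by rewrite AE ?eqxx.
- by rewrite fill_mem_in /f fE.
- by rewrite fill_mem_other.
Qed.

(** What every round preserves.  That S consists of the first #|S| entries of the
    list of chosen columns entails that these entries are distinct. *)
Definition selection_state (P : 'M[R]_m) (S : {set 'I_n}) (s : memory R) :=
  [/\ flags s.1 S,
      S = [set j : 'I_n | [exists i : 'I_#|S|, s.1 out i == j]]%SET,
      loaded s.2 white_arr P,
      loaded s.2 accum_arr (outer_sum (P *m X) S)
    & barrier (outer_sum (P *m X) S) (level R m k #|S|) (height R m k)].

Hypotheses (m_gt0 : (0 < m)%N) (le_mk : (m <= k)%N).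
Hypothesis evdP : evd_correct (@evd R sub).

Lemma evd_spectral (A : rmem R) a (M : 'M[R]_m) :
  loaded A a M -> M^T = M ->
  let ev := evd sub (\matrix_(i < m, j < m) A a i j) in
  ev.1 *m ev.1^T = 1%:M /\ M = spectral_mx ev.1 (fun i => ev.2 0 i).
Proof.
move=> AM Mt ev; have ME : \matrix_(i < m, j < m) A a i j = M.
  by apply/matrixP => i j; rewrite mxE AM.
by have := evdP Mt; rewrite -{1}ME -/ev; case: ev => U lam /= [UU {1}->]; rewrite spectral_mxE.
Qed.

Lemma selection_round_spec P (S : {set 'I_n}) (N : imem) (A : rmem R) :
  (P *m X) *m (P *m X)^T = n%:R%:M -> (#|S| < n)%N -> N round_var 0%N = #|S| ->
  selection_state P S (N, A) ->
  exists j : 'I_n, [/\ j \notin S, selection_state P (j |: S) (mexec selection_round (N, A))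
    & (mexec selection_round (N, A)).1 round_var 0%N = #|S|].
Proof.
move=> tight Sn Nt [NS SE AP AS bar]; rewrite /= in NS SE AP AS.
have [A1 [E1 A1U A1w A1other]] := spectral_phase_spec A Nt.
have [UU outerE] := evd_spectral AS (outer_sum_sym _ _).
set ev := evd sub _ in A1U A1w UU outerE.
have A1P : loaded A1 white_arr P by move=> i j; rewrite A1other.
have [A2 [E2 A2score A2other]] := score_phase_spec N A1U A1P.
have [j [jS jmax E3]] := choice_phase_spec A2 NS Sn.
have [| | |i1 i2|i1 i2|A3 [E4 A3S A3other]] :=
    @update_phase_spec (iput N best_var 0 j) A2 P S #|S| j.
- by [].
- by [].
- by [].
- by rewrite A2other // A1other.
- by rewrite A2other // A1other.
have E : mexec selection_round (N, A) =
    (iput (iput (iput N best_var 0 j) out #|S| j) used_arr j 1%N, A3).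
  by rewrite /selection_round mexec_seq E1 mexec_seq E2 mexec_seq E3 E4.
exists j; rewrite E; split=> //; split=> //=.
- move=> j'; rewrite /iput /= in_setU1 -[(j' == j)]val_eqE /=.
  by case: (nat_of_ord j' =P j) => //= _; exact: NS.
- rewrite cardsU1 jS add1n; apply/setP => j'; rewrite !inE.
  apply/orP/existsP => [[/eqP->|]|[i]].
  + by exists ord_max; rewrite /= /iput /= eqxx.
  + rewrite {1}SE inE => /existsP[i iE]; exists (widen_ord (leqnSn _) i).
    by rewrite /= /iput /= (ltn_eqF (ltn_ord i)).
  + rewrite /iput /=; case: (nat_of_ord i =P #|S|) => [_|iS].
      by rewrite val_eqE eq_sym => ->; left.
    move=> iE; right; rewrite SE inE; apply/existsP.
    have il : (i < #|S|)%N by rewrite ltn_neqAle -ltnS ltn_ord andbT; apply/eqP.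
    by exists (Ordinal il).
- by move=> i1 i2; rewrite A3other // A2other // A1other.
- apply: (barrier_step m_gt0 le_mk tight UU outerE bar jS) => j' j'S.
  have scoreE j1 : score k (P *m X) ev.1 (fun i => ev.2 0 i) (level R m k #|S|.+1) j1 =
      A2 score_arr 0%N j1.
    by rewrite A2score; apply: eq_bigr => i _; rewrite A1w.
  by rewrite !scoreE jmax.
Qed.
Lemma selection_state_round_var P (S : {set 'I_n}) (N : imem) (A : rmem R) v :
  selection_state P S (N, A) -> selection_state P S (iput N round_var 0%N v, A).
Proof. by case=> NS SE AP AS bar; split. Qed.

Lemma selection_rounds_spec P (N : imem) (A : rmem R) :
  (P *m X) *m (P *m X)^T = n%:R%:M -> (k <= n)%N ->
  selection_state P finset.set0 (N, A) ->
  exists S : {set 'I_n}, #|S| = k /\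
    selection_state P S (mexec (For round_var IDimK selection_round) (N, A)).
Proof.
move=> tight kn start.
pose step i s' := mexec selection_round (iput s'.1 round_var 0 i, s'.2).
pose Inv l (s' : memory R) := exists S : {set 'I_n}, #|S| = l /\ selection_state P S s'.
have [S [Sk stateS]] : Inv k (iteri k step (N, A)).
  apply: iteri_ind => [|i s' ik [S [Si stateS]]].
    by exists finset.set0; rewrite cards0.
  have := @selection_round_spec P S (iput s'.1 round_var 0 i) s'.2 tight.
  rewrite Si => /(_ (leq_trans ik kn) erefl).
  case: s' stateS => N' A' stateS /(_ (selection_state_round_var _ stateS))[j [jS state' _]].
  by exists (j |: S); rewrite cardsU1 jS add1n Si.
exists S; split; first by [].
have -> : mexec (For round_var IDimK selection_round) (N, A) =
  (iput (iteri k step (N, A)).1 round_var 0 (N round_var 0%N), (iteri k step (N, A)).2) by [].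
by apply: selection_state_round_var; case: (iteri _ _ _) stateS.
Qed.

Lemma gram_expE (N : imem) (A : rmem R) (i j : 'I_m) :
  N row_var 0%N = i -> N col_var 0%N = j ->
  reval k X N A gram_exp = (X *m X^T) i j.
Proof.
move=> Ni Nj; rewrite /gram_exp reval_sum mxE; apply: eq_bigr => l _.
by rewrite mxE -!entryE -Ni -Nj.
Qed.

Lemma whitening_expE (N : imem) (A : rmem R) (W : 'M[R]_m) (g : 'I_m -> R) (i j : 'I_m) :
  N row_var 0%N = i -> N col_var 0%N = j ->
  loaded A evec_arr W -> (forall i : 'I_m, A eval_arr 0%N i = g i) ->
  reval k X N A whitening_exp = whitening n W g i j.
Proof. by move=> Ni Nj AW Ag; rewrite mxE -Ag -AW -Ni -Nj. Qed.

Lemma whitening_phase_spec (N : imem) (A : rmem R) :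
  exists A' W g, [/\ mexec whitening_phase (N, A) = (N, A'),
    W *m W^T = 1%:M /\ X *m X^T = spectral_mx W g,
    loaded A' white_arr (whitening n W g)
    & forall i j, A' accum_arr i j = A accum_arr i j].
Proof.
pose f1 i j := reval k X (iput (iput N row_var 0 i) col_var 0 j) A gram_exp.
set A1 := fill_mem A gram_arr m m f1.
have A1G : loaded A1 gram_arr (X *m X^T).
  by move=> i j; rewrite /A1 fill_mem_in /f1 (gram_expE _ (i := i) (j := j)).
have [WW gramE] := evd_spectral A1G (eq_trans (trmx_mul _ _) (congr1 (mulmx^~ _) (trmxK _))).
set A2 := evd_mem sub A1 gram_arr evec_arr eval_arr m.
set ev := evd sub _ in WW gramE; pose g i := ev.2 0 i.
pose f2 i j := reval k X (iput (iput N row_var 0 i) col_var 0 j) A2 whitening_exp.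
have f2E (i j : 'I_m) (A' : rmem R) : (forall a i j, a != white_arr -> A' a i j = A2 a i j) ->
    reval k X (iput (iput N row_var 0 i) col_var 0 j) A' whitening_exp =
    whitening n ev.1 g i j.
  move=> A'E; apply: whitening_expE => // [i1 j1|i1]; rewrite A'E //.
    by rewrite /A2 evd_mem_vec.
  by rewrite /A2 evd_mem_row.
exists (fill_mem A2 white_arr m m f2), ev.1, g; split=> // [|i j|i j].
- rewrite /whitening_phase mexec_seq.
  rewrite (@mexec_fill _ _ _ _ _ _ gram_arr _ _ _ _ _ _ _ f1 m) //.
  rewrite mexec_seq mexec_evd; apply: mexec_fill => // i j A' im jm A'E.
  rewrite /f2 (@f2E (Ordinal im) (Ordinal jm)) => [|a i' j' a5]; last by rewrite A'E ?a5.
  by rewrite (@f2E (Ordinal im) (Ordinal jm)).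
- by rewrite fill_mem_in /f2 f2E.
- by rewrite fill_mem_other // /A2 evd_mem_other // /A1 fill_mem_other.
Qed.

Lemma barrier_selection_spec TX : row_free X -> (k <= n)%N -> (0 < n)%N ->
  let S := selected sub k X TX barrier_selection in
  [/\ #|S| = k, row_free (colset X S)
    & forall xi, mxnorm xi (mpinv (colset X S)) ^+ 2
        <= sharp_factor R m n k * mxnorm xi (mpinv X) ^+ 2].
Proof.
move=> X_free kn n_gt0; set s0 : memory R := (fun _ _ => 0%N, fun _ _ _ => 0).
have [A [W [g [E1 [WW gramE] AP AS]]]] := whitening_phase_spec s0.1 s0.2.
set P := whitening n W g in AP.
have start : selection_state P finset.set0 (s0.1, A).
  split=> //.
  - by move=> j; rewrite inE.
  - by apply/setP => j; rewrite !inE; symmetry; apply/negbTE/existsP => -[[i]]; rewrite cards0.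
  - by move=> i j; rewrite /= AS /outer_sum big_set0 mxE.
  - by rewrite cards0; exact: barrier_init.
have tight := whitening_tight X_free WW gramE.
have [S [Sk [_ SE _ _ bar]]] := selection_rounds_spec tight kn start.
have -> : selected sub k X TX barrier_selection = S.
  apply/setP => j; rewrite selected_mexec /barrier_selection mexec_seq E1.
  by rewrite [in RHS]SE inE Sk.
rewrite Sk in bar.
have := evdP (outer_sum_sym (P *m X) S); case: (evd sub _) => U lam [UU].
rewrite spectral_mxE => outerE; split=> // [|xi].
  exact: (selection_row_free m_gt0 le_mk n_gt0 X_free WW gramE UU outerE bar).
exact: (selection_sharp m_gt0 le_mk n_gt0 X_free WW gramE UU outerE bar).
Qed.
End Correctness.

(** * Running time of the program *)

(** Every monomial of the cost is at most k m^3 or k m TX, and the coefficients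
    sum to less than 1000. *)
Lemma barrier_selection_cost m n k TX :
  (0 < m)%N -> (m <= k)%N -> (m < n)%N -> (n <= TX)%N ->
  (cmd_cost m n k TX barrier_selection <= 1000 * (k * m ^ 3 + k * m * TX))%N.
Proof.
move=> m_gt0 mk mn nTX; cbn -[addn muln expn leq]; rewrite /static_value /=.
have k_gt0 : (0 < k)%N by exact: leq_trans mk.
have le_kmTX a : (a <= k * m)%N -> (a * n <= k * m * TX)%N by move=> ?; exact: leq_mul.
have t1 : (k * n <= k * m * TX)%N by apply: le_kmTX; rewrite leq_pmulr.
have t2 : (k * m * n <= k * m * TX)%N by exact: le_kmTX.
have t3 : (m * m * n <= k * m * TX)%N by apply: le_kmTX; rewrite leq_pmul2r.
have s1 : (k * m * m <= k * (m * m * m))%N by rewrite -mulnA leq_pmul2l // leq_pmulr.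
have s2 : (k * m <= k * m * m)%N by rewrite leq_pmulr.
have s3 : (k <= k * m)%N by rewrite leq_pmulr.
have s4 : (m * m * m <= k * (m * m * m))%N by rewrite leq_pmull.
have s5 : (m * m <= k * m)%N by rewrite leq_pmul2r.
have -> : (m ^ 3 = m * m * m)%N by rewrite !expnSr expn0 mul1n.
clear le_kmTX; lia.
Qed.

Lemma dense_barrier_selection_cost m n k TX :
  (0 < m)%N -> (m <= k)%N -> (m < n)%N ->
  (cmd_cost m n k TX (dense barrier_selection) <= 1000 * (n * k * m ^ 2))%N.
Proof.
move=> m_gt0 mk mn; cbn -[addn muln expn leq]; rewrite /static_value /=.
have k_gt0 : (0 < k)%N by exact: leq_trans mk.
have n_gt0 : (0 < n)%N by exact: leq_trans mn.
have t1 : (k * n <= k * n * m)%N by rewrite leq_pmulr.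
have t2 : (k * n * m <= k * n * (m * m))%N by rewrite leq_pmul2l ?muln_gt0 ?k_gt0 // leq_pmulr.
have t3 : (n * (m * m) <= k * n * (m * m))%N by rewrite -mulnA leq_pmull.
have s1 : (k * m * m * m <= k * n * (m * m))%N.
  by rewrite -!mulnA leq_pmul2l // leq_mul ?(ltnW mn).
have s2 : (k * m * m <= k * m * m * m)%N by rewrite leq_pmulr.
have s3 : (k * m <= k * m * m)%N by rewrite leq_pmulr.
have s4 : (k <= k * m)%N by rewrite leq_pmulr.
have s5 : (m * m * m <= k * m * m * m)%N by rewrite -!mulnA leq_pmull.
have s6 : (m * m <= k * m)%N by rewrite leq_pmul2r.
have -> : (m ^ 3 = m * m * m)%N by rewrite !expnSr expn0 mul1n.
have -> : (m ^ 2 = m * m)%N by rewrite expnS expn1.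
lia.
Qed.

Theorem theorem1 :
  exists (alg : cmd) (C : nat),
  forall (R : realType) (eps : R) (sub : subroutines R)
         (m n k TX : nat) (X : 'M[R]_(m, n)),
    0 < eps -> correct_subroutines eps sub ->
    (0 < m)%N -> (m < n)%N -> (m <= k <= n)%N ->
    \rank X = m -> (n <= TX)%N ->
    let S := selected sub k X TX alg in
    [/\ #|S| = k,
        \rank (colset X S) = m,
        (forall xi : norm_kind,
           mxnorm xi (mpinv (colset X S)) ^+ 2
             <= sharp_factor R m n k * mxnorm xi (mpinv X) ^+ 2),
        (forall xi : norm_kind,
           mxnorm xi (mpinv (colset X S)) ^+ 2
             <= loose_factor R m n k * mxnorm xi (mpinv X) ^+ 2)
      & (operations sub k X TX alg <= C * (k * m ^ 3 + k * m * TX))%N]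
    /\
    (selected sub k X TX (dense alg) = S /\
     (operations sub k X TX (dense alg) <= C * (n * k * m ^ 2))%N).
Proof.
exists barrier_selection, 1000%N.
move=> R eps sub m n k TX X _ [evdP _ _] m_gt0 mn /andP[mk kn] rankX nTX S.
have X_free : row_free X by rewrite /row_free rankX.
have [cardS S_free sharp] :=
  barrier_selection_spec m_gt0 mk evdP TX X_free kn (leq_ltn_trans (leq0n m) mn).
split; last first.
  split; first by apply/setP => j; rewrite !selected_mexec mexec_dense.
  apply: leq_trans (dense_barrier_selection_cost TX m_gt0 mk mn).
  exact: (@exec_cost m n k TX R sub X (dense barrier_selection) (init R)).
split=> //; first exact/eqP.
- move=> xi; apply: le_trans (sharp xi) _.
  by rewrite ler_wpM2r ?sqr_ge0 // sharp_le_loose.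
- apply: leq_trans (barrier_selection_cost m_gt0 mk mn nTX).
  exact: (@exec_cost m n k TX R sub X barrier_selection (init R)).
Qed.
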